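(* Let $\hat{\mathcal{C}}$ be a finite active constellation of crosses above $O$ and let $\Lambda(\hat{\mathcal{C}})$ be its associated lotus. Then the dual graph $G(X_{\hat{\mathcal{C}}})$ of the total transform $X_{\hat{\mathcal{C}}}$ of $\hat{\mathcal{C}}$ is isomorphic to the lateral boundary $\partial_+ \Lambda( \hat{\mathcal{C}} )$ of $\Lambda( \hat{\mathcal{C}} )$. The weight of a lateral vertex of the dual graph (that is, the self-intersection number of the corresponding exceptional curve in the model $S_{\mathcal{C}}$) is equal to the opposite of the number of petals of the lotus incident to it, when we see it as a vertex of the lotus.
   Context: **Infinitely near points and crosses.** $(S,O)$ is a germ of smooth complex analytic surface. A model is a composition of finitely many blowups of points above $O$. An infinitely near point of $O$ is $O$ or a point of the exceptional divisor of a model, points on two models being identified if the natural bimeromorphic map is a biholomorphism near them; $S^P$ is the minimal model containing $P$, and $E_P$ is the exceptional curve created by blowing up $P$ (also denoting its strict transforms). $P\preceq Q$ means that $Q$ is infinitely near $P$; then there is a morphism $\pi^Q_P:S^Q\to S^P$. A constellation is a set $\mathcal{C}$ of infinitely near points such that $Q\in\mathcal{C}$, $P\preceq Q$ imply $P\in\mathcal{C}$; it is active if one has chosen a subset of active points containing all non-maximal points; the others are inactive. A cross at $P$ is a reduced germ of normal crossings divisor with two branches at $P$. A constellation of crosses $\hat{\mathcal{C}}$ is a constellation $\mathcal{C}$ with a cross $X_P$ on $(S^P,P)$ for each $P\in\mathcal{C}$, such that the germ at $Q$ of $(\pi^Q_P)^{-1}(X_P)$ is contained in $X_Q$ whenever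 $P\preceq Q$. $S_{\mathcal{C}}$ is the model obtained by blowing up all active points, and $X_{\hat{\mathcal{C}}}$ is the reduced total transform on $S_{\mathcal{C}}$ of all the crosses. **Lotus.** The dual segment of a cross is a segment with vertices labeled by its two branches. The lotus $\Lambda(\hat{\mathcal{C}})$ is the simplicial complex built by starting from the dual segment of $X_O=L+L_1$ and going through the points of $\mathcal{C}$ in an order compatible with $\preceq$: (A) when $P$ is active, glue a triangle (petal) with vertices the branches of $X_P$ and $E_P$ along the dual segment of $X_P$ (its base), identifying vertices with the same label; (B) for a point $Q\neq O$, if the germ at $Q$ of the current total transform is a cross, this is $X_Q$, whose dual segment is already present; otherwise $X_Q=E+L_Q$ with $E$ the germ of the exceptional divisor and $L_Q$ smooth transversal to it (a curvetta), and one glues the dual segment of $X_Q$ at the vertex $E$. Base edges: the dual segment of $X_O$ and the segments glued in the second case of (B). Lateral edges: the dual segments of the crosses formed by germs of $X_{\hat{\mathcal{C}}}$ at its singular points, which are not base edges. The lateral boundary $\partial_+\Lambda(\hat{\mathcal{C}})$ is the union of the lateral edges and of the base edges dual to crosses at inactive points. Base vertices: $L$, $L_1$ and all $L_Q$; lateral vertices: all $E_P$, $P$ active. **Weighted dual graph.** For a reduced normal crossing divisor $D$ with smooth components on a smooth surface, $G(D)$ has one vertex per irreducible component of $D$, its edges are the dual segments of the crosses formed by germs of $D$ at its singular points, and each vertex corresponding to a compact component is weighted by its self-intersection number. *)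

(* Defs.v *)
From HB Require Import structures.
From mathcomp Require Import all_boot all_order all_algebra.
From mathcomp Require Import complex.
From mathcomp Require Import all_classical all_reals.

Set Implicit Arguments.
Unset Strict Implicit.
Unset Printing Implicit Defensive.

Import Order.TTheory GRing.Theory Num.Theory.

Local Open Scope ring_scope.
Local Open Scope complex_scope.
Local Open Scope classical_set_scope.

(* A germ of smooth complex analytic surface is (C^2, 0) in a system of local
    coordinates, and its ring of germs of holomorphic functions is C{x, y}.
    Here C is [R[i]] for [R : realType]. *)

(* [a i j] is the coefficient of x^i y^j. *)
Definition series (R : realType) : Type := nat -> nat -> R[i].

(* Cauchy's estimates: membership in C{x, y}. *)
Definition convergent (R : realType) (a : series R) : Prop :=
  exists r M : R[i], 0 < r /\ forall i j, `|a i j| * r ^+ (i + j) <= M.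

Definition sone (R : realType) : series R :=
  fun i j => ((i == 0%N) && (j == 0%N))%:R.

Definition sX (R : realType) : series R :=
  fun i j => ((i == 1%N) && (j == 0%N))%:R.

Definition szero (R : realType) : series R := fun _ _ => 0.

Definition smul (R : realType) (a b : series R) : series R :=
  fun i j => \sum_(k < i.+1) \sum_(l < j.+1) a k l * b (i - k)%N (j - l)%N.

Definition sexp (R : realType) (a : series R) (n : nat) : series R :=
  iter n (smul a) (sone R).

(* Membership of [a - b] in the n-th power of the maximal ideal. *)
Definition eq_jet (R : realType) (n : nat) (a b : series R) : Prop :=
  forall i j, (i + j < n)%N -> a i j = b i j.

Definition sunit (R : realType) (a : series R) : Prop :=
  convergent a /\ exists2 b, convergent b & smul a b = sone R.

Definition sirreducible (R : realType) (f : series R) : Prop :=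
  [/\ convergent f, f <> szero R, ~ sunit f &
      forall a b, convergent a -> convergent b -> f = smul a b ->
        sunit a \/ sunit b].

Definition ideal (R : realType) (f : series R) : set (series R) :=
  [set h | exists2 w, convergent w & h = smul f w].

(* A branch is an irreducible germ of curve; it is represented by its ideal,
    which is generated by an irreducible series.  A reduced germ of curve is
    represented by the set of its branches. *)

Definition is_branch (R : realType) (I : set (series R)) : Prop :=
  exists2 f, sirreducible f & I = ideal f.

Definition is_smooth_branch (R : realType) (I : set (series R)) : Prop :=
  exists f : series R,
    [/\ convergent f, f 0%N 0%N = 0,
        f 1%N 0%N != 0 \/ f 0%N 1%N != 0 & I = ideal f].

(* The differentials of f and g at the point are linearly independent. *)
Definition is_cross (R : realType) (X : set (set (series R))) : Prop :=
  exists f g : series R,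
    [/\ convergent f /\ convergent g, f 0%N 0%N = 0 /\ g 0%N 0%N = 0,
        f 1%N 0%N * g 0%N 1%N - f 0%N 1%N * g 1%N 0%N != 0 &
        X = [set ideal f; ideal g]].

(* The exceptional curve E_P created by blowing up P is the projective line of
    tangent directions at P.  An infinitely near point Q <> O belongs to E_P,
    as a point of S^Q, for exactly one P, its immediate predecessor for the
    order, and S^Q is obtained from S^P by blowing up P.  Hence an infinitely
    near point, up to the identification of the points of different models,
    is the word of the successive directions leading from O = [::] to it;
    P <= Q in the order of infinitely near points iff P is a prefix of Q. *)

(* [Some c] is the direction (1 : c) and [None] is the direction (0 : 1). *)
Definition direction (R : realType) : Type := option R[i].

Definition ipoint (R : realType) : choiceType := seq (direction R).

Definition ile (R : realType) (P Q : ipoint R) : Prop := prefix P Q.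

Definition ilt (R : realType) (P Q : ipoint R) : Prop := ile P Q /\ P <> Q.

(* The blowup of P, read from the local coordinates (u, v) at the point t of
   E_P to the local coordinates (x, y) at P, is
     x = u X_t(v), y = u Y_t(v)  with  (X_t, Y_t) = (1, c + v) or (v, 1),
   so that E_P is {u = 0} in the neighbourhood of each of its points.  *)
Definition chart (R : realType) (t : direction R) : {poly R[i]} * {poly R[i]} :=
  if t is Some c then (1, c%:P + 'X) else ('X, 1).

(* The coefficient of u^n v^l in a (u X_t(v), u Y_t(v)). *)
Definition pull1 (R : realType) (t : direction R) (a : series R) : series R :=
  fun n l =>
    (\sum_(i < n.+1)
       a i (n - i)%N *: ((chart t).1 ^+ i * (chart t).2 ^+ (n - i)))`_l.

(* Composition with the morphism from S^Q, near Q, to S^P, for Q = P ++ s. *)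
Definition pull (R : realType) (s : seq (direction R)) (a : series R) :
    series R :=
  foldl (fun f t => pull1 t f) a s.

(* The branches at Q of the preimage of a germ X of curve at P. *)
Definition preimage_germ (R : realType) (P Q : ipoint R)
    (X : set (set (series R))) : set (set (series R)) :=
  [set I | is_branch I /\
     exists s f, [/\ Q = P ++ s, convergent f, X (ideal f) & I (pull s f)]].

(* [J] is a branch at the point t of E_P of the strict transform, by the blowup
   of P, of the branch [I] at P. *)
Definition strict_transform (R : realType) (t : direction R)
    (I J : set (series R)) : Prop :=
  [/\ is_branch J, J <> ideal (sX R) & forall f, I f -> J (pull1 t f)].

(* Finite active constellations of crosses; the cross at the origin, from which
   the lotus is built, is part of the data. *)
Record constellation (R : realType) : Type := Constellation {
  points : set (ipoint R);
  active : set (ipoint R);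
  cross : ipoint R -> set (set (series R));
  points_finite : finite_set points;
  points_origin : points [::];
  points_closed : forall P Q, points Q -> ile P Q -> points P;
  active_points : active `<=` points;
  active_nonmaximal : forall P Q, points Q -> ilt P Q -> active P;
  cross_is_cross : forall P, points P -> is_cross (cross P);
  cross_compatible : forall P Q, points P -> points Q -> ile P Q ->
    preimage_germ P Q (cross P) `<=` cross Q }.

(* The points of the exceptional divisor of the model obtained by blowing up
   all the active points ([::] alone if there are none). *)
Definition model_point (R : realType) (C : constellation R) : set (ipoint R) :=
  [set Q | ~ active C Q /\ forall P, ilt P Q -> active C P].

(* The branches at [Q], a model point, of the total transform of the crosses. *)
Definition total_transform (R : realType) (C : constellation R)
    (Q : ipoint R) : set (set (series R)) :=
  [set I | exists P,
     [/\ points C P, ile P Q & preimage_germ P Q (cross C P) I]].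

(* [Exc P] is E_P, and [Bra P I] is the irreducible curve whose germ at P is
    the non-exceptional branch I.  Both also denote their strict transforms. *)

Inductive curve (R : realType) : Type :=
| Exc of ipoint R
| Bra of ipoint R & set (series R).

(* [germ_of v Q I]: [I] is a branch at Q of the strict transform of [v]. *)
Inductive germ_of (R : realType) :
    curve R -> ipoint R -> set (series R) -> Prop :=
| germ_exc P t : germ_of (Exc P) (rcons P t) (ideal (sX R))
| germ_bra P I : germ_of (Bra P I) P I
| germ_strict v P t I J : germ_of v P I -> strict_transform t I J ->
    germ_of v (rcons P t) J.

Record graph (V E : Type) : Type := Graph {
  vertices : set V;
  edges : set E;
  ends : E -> set V }.

Definition graph_isomorphism (V E V' E' : Type)
    (G : graph V E) (G' : graph V' E') (phi : V -> V') (psi : E -> E') : Prop :=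
  [/\ set_bij (vertices G) (vertices G') phi,
      set_bij (edges G) (edges G') psi &
      forall e, edges G e -> ends G' (psi e) = phi @` ends G e].

(* The irreducible curves on the model obtained by blowing up all the active
   points: exceptional curves, and germs of curves at one point of the
   exceptional divisor which are not contained in it. *)
Definition model_curve (R : realType) (C : constellation R) (v : curve R) :
    Prop :=
  match v with
  | Exc P => active C P
  | Bra Q J => [/\ model_point C Q, is_branch J &
                   forall P, ~ germ_of (Exc P) Q J]
  end.

Definition component (R : realType) (C : constellation R) : set (curve R) :=
  [set v | model_curve C v /\
     forall Q I, model_point C Q -> germ_of v Q I -> total_transform C Q I].

Definition singular_point (R : realType) (C : constellation R) :
    set (ipoint R) :=
  [set Q | [/\ model_point C Q, total_transform C Q !=set0 &
     ~ exists2 I, is_smooth_branch I & total_transform C Q = [set I]]].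

(* The edges are indexed by the singular points. *)
Definition dual_graph (R : realType) (C : constellation R) :
    graph (curve R) (ipoint R) :=
  Graph (component C) (singular_point C)
    (fun Q => [set v | component C v /\
       exists2 I, total_transform C Q I & germ_of v Q I]).

(* The self-intersection number of a compact curve E is the degree of the line
    bundle O(E)|_E, computed by means of the section defined by 1/h, where h is
    a meromorphic function, pulled back from S, with divisor containing E with
    multiplicity 1.  If e is a local equation of E, this section is (e/h)|_E in
    the trivialization of O(E) given by 1/e. *)

(* The function f|_E has order m at the point, E = {e = 0} being smooth: its
   order in the discrete valuation ring C{u, v}/(e). *)
Definition order_on (R : realType) (e f : series R) (m : nat) : Prop :=
  (exists2 w, convergent w & eq_jet m f (smul e w)) /\
  ~ (exists2 w, convergent w & eq_jet m.+1 f (smul e w)).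

(* [a/b] has multiplicity 1 along E = {e = 0}, whose ideal is [I], and
   (e b / a)|_E has order [m] at the point. *)
Definition section_order (R : realType) (I : set (series R)) (a b : series R)
    (m : int) : Prop :=
  exists (e a' b' : series R) (k ma mb : nat),
    [/\ [/\ convergent e, convergent a' & convergent b'],
        I = ideal e,
        a = smul (sexp e k.+1) a' /\ b = smul (sexp e k) b',
        ~ I a' /\ ~ I b' &
        [/\ order_on e a' ma, order_on e b' mb & m = mb%:Z - ma%:Z]].

Definition exceptional_points (R : realType) (C : constellation R)
    (P : ipoint R) : set (ipoint R) :=
  [set Q | model_point C Q /\ exists I, germ_of (Exc P) Q I].

Definition is_self_intersection (R : realType) (C : constellation R)
    (P : ipoint R) (n : int) : Prop :=
  exists (a b : series R) (ord : ipoint R -> int),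
    [/\ convergent a /\ convergent b,
        forall Q I, model_point C Q -> germ_of (Exc P) Q I ->
          section_order I (pull Q a) (pull Q b) (ord Q),
        finite_set (exceptional_points C P `&` [set Q | ord Q != 0]) &
        n = \sum_(Q \in exceptional_points C P) ord Q].

Definition self_intersection (R : realType) (C : constellation R)
    (P : ipoint R) : int :=
  xget 0 [set n | is_self_intersection C P n].

Definition weight (R : realType) (C : constellation R) (v : curve R) :
    option int :=
  if v is Exc P then Some (self_intersection C P) else None.

(* The germ at [Q] of the current total transform when the construction of the
   lotus reaches [Q]: only the points strictly below Q contribute to it. *)
Definition current_transform (R : realType) (C : constellation R)
    (Q : ipoint R) : set (set (series R)) :=
  [set I | exists P,
     [/\ points C P, ilt P Q & preimage_germ P Q (cross C P) I]].

(* The points at which the dual segment of the cross is glued as a new segment.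
   The origin is one of them, as [current_transform C [::]] is empty. *)
Definition base_point (R : realType) (C : constellation R) : set (ipoint R) :=
  [set Q | points C Q /\ ~ is_cross (current_transform C Q)].

(* L and L_1 at the origin, and the curvettas L_Q. *)
Definition base_vertex (R : realType) (C : constellation R) : set (curve R) :=
  [set v | exists Q I, [/\ base_point C Q, cross C Q I,
                           ~ current_transform C Q I & v = Bra Q I]].

Definition lateral_vertex (R : realType) (C : constellation R) :
    set (curve R) :=
  [set Exc P | P in active C].

(* The set of the vertices labeled by the branches at [Q] of the cross [X]. *)
Definition dual_segment (R : realType) (C : constellation R) (Q : ipoint R)
    (X : set (set (series R))) : set (curve R) :=
  [set v | (base_vertex C v \/ lateral_vertex C v) /\
     exists2 I, X I & germ_of v Q I].

Definition petal_at (R : realType) (C : constellation R) (P : ipoint R) :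
    set (curve R) :=
  Exc P |` dual_segment C P (cross C P).

(* Segments and petals are represented by their sets of vertices. *)
Definition petal (R : realType) (C : constellation R) : set (set (curve R)) :=
  [set petal_at C P | P in active C].

Definition base_edge (R : realType) (C : constellation R) :
    set (set (curve R)) :=
  [set dual_segment C Q (cross C Q) | Q in base_point C].

(* The simplicial complex: all the faces of the base edges and petals. *)
Definition lotus (R : realType) (C : constellation R) : set (set (curve R)) :=
  [set s | s !=set0 /\
     exists2 m, (base_edge C `|` petal C) m & s `<=` m].

Definition lateral_edge (R : realType) (C : constellation R) :
    set (set (curve R)) :=
  [set s | [/\ lotus C s, ~ base_edge C s &
     exists2 Q, singular_point C Q &
       s = dual_segment C Q (total_transform C Q)]].

Definition inactive_base_edge (R : realType) (C : constellation R) :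
    set (set (curve R)) :=
  [set dual_segment C Q (cross C Q) | Q in base_point C `\` active C].

Definition lateral_boundary (R : realType) (C : constellation R) :
    graph (curve R) (set (curve R)) :=
  let E := lateral_edge C `|` inactive_base_edge C in
  Graph (\bigcup_(e in E) e) E id.

Definition incident_petals (R : realType) (C : constellation R)
    (v : curve R) : set (set (curve R)) :=
  [set T | petal C T /\ T v].

(* Main.v *)
Require Import Defs.
From HB Require Import structures.
From mathcomp Require Import all_boot all_order all_algebra.
From mathcomp Require Import complex finmap.
From mathcomp Require Import all_classical all_reals.
From mathcomp Require Import ring zify.

Set Implicit Arguments.
Unset Strict Implicit.
Unset Printing Implicit Defensive.

Import Order.TTheory GRing.Theory Num.Theory.

Local Open Scope ring_scope.
Local Open Scope complex_scope.
Local Open Scope classical_set_scope.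

(* Both graphs are read off the infinitely near points.  At a point Q all of whose
   predecessors are active, the germ of the total transform is either a cross or the
   exceptional curve alone, and its branches are the germs of pairwise distinct vertices
   of the lotus.  Two distinct vertices share at most one such cross, because the
   strict transforms of the two branches of a cross are separated by blowing up; and a
   base vertex is followed, through its only tangent direction, to a point of the model.

   For the weights, take h = a/b of multiplicity 1 along E_P.  At P, the leading forms of
   b and a have degrees q and q + 1, and their zeros on E_P, the projective line of
   directions, give the contribution q - (q + 1) = -1; each further blowup of a point of
   E_P lowers the order of the section 1/h by q + 1 - q = 1.  Hence the self-intersection
   of E_P is -1 minus the number of the active points through which E_P passes, and these
   points, together with P, are those whose petals are incident to E_P. *)

(** * The ring of power series and its blowups *)

Section SeriesRing.
Variable R : realType.
Notation S := (series R).

(** A branch is an ideal generated by an irreducible series, and the argument avoids unique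
    factorization in C{x, y}. This is possible because branches of crosses are smooth: their
    pull-backs keep an explicit shape, from which coordinates and units can be cancelled. Units are
    recognized by their constant term, which is why inverse series must be shown to converge.
    Compatibility of the crosses makes the geometry local: just above an active point P the total
    transform depends on X_P alone, so all statements on germs go by induction on the word of
    directions. Edges of the dual graph are points, whereas segments and petals are sets of
    vertices. Hence injectivity statements are needed both to match edges and to count petals. The
    self-intersection number is defined through an arbitrary quotient a/b. Its value requires one
    admissible quotient, a local coordinate at P, and independence of the choice. Both follow from
    one computation of local orders, where a form of degree p has exactly p zeros on the projective
    line because [R[i]] is algebraically closed. *)

Lemma seriesP (a b : S) : (forall i j, a i j = b i j) -> a = b.
Proof. by move=> h; apply/funext => i; apply/funext => j. Qed.

Definition series_of_poly (p : {poly {poly R[i]}}) : S := fun i j => p`_i`_j.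

Definition truncate (N : nat) (a : S) : {poly {poly R[i]}} :=
  \poly_(i < N) \poly_(j < N) a i j.

Lemma truncateE N a i j : (i < N)%N -> (j < N)%N ->
  series_of_poly (truncate N a) i j = a i j.
Proof. by move=> iN jN; rewrite /series_of_poly coef_poly iN coef_poly jN. Qed.

(** A coefficient of a product sees only coefficients of smaller or equal indices. Ring identities
    for series can thus be checked on truncations, that is, in [{poly {poly R[i]}}]. *)
Lemma smul_local (a a' b b' : S) i j :
  (forall k l, (k <= i)%N -> (l <= j)%N -> a k l = a' k l) ->
  (forall k l, (k <= i)%N -> (l <= j)%N -> b k l = b' k l) ->
  smul a b i j = smul a' b' i j.
Proof.
move=> ha hb; apply: eq_bigr => k _; apply: eq_bigr => l _.
by rewrite ha ?hb ?leq_subr // -ltnS ltn_ord.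
Qed.

Lemma series_of_polyM p q :
  series_of_poly (p * q) = smul (series_of_poly p) (series_of_poly q).
Proof.
apply: seriesP => i j; rewrite /series_of_poly coefM coef_sum.
by apply: eq_bigr => k _; rewrite coefM.
Qed.

Lemma smul_truncate N (a b : S) i j : (i < N)%N -> (j < N)%N ->
  smul a b i j = series_of_poly (truncate N a * truncate N b) i j.
Proof.
move=> iN jN; rewrite series_of_polyM.
by apply: smul_local => k l ki lj; rewrite truncateE ?(leq_ltn_trans ki) ?(leq_ltn_trans lj).
Qed.

Lemma smulC : commutative (@smul R).
Proof.
move=> a b; apply: seriesP => i j.
have iN : (i < (i + j).+1)%N by lia.
have jN : (j < (i + j).+1)%N by lia.
by rewrite !(smul_truncate _ _ iN jN) mulrC.
Qed.

Lemma smulA : associative (@smul R).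
Proof.
move=> a b c; apply: seriesP => i j; pose N := (i + j).+1.
have iN : (i < N)%N by rewrite /N; lia.
have jN : (j < N)%N by rewrite /N; lia.
have loc k m : (k <= m)%N -> (m < N)%N -> (k < N)%N by move=> *; lia.
transitivity (smul (series_of_poly (truncate N a))
    (series_of_poly (truncate N b * truncate N c)) i j).
  by apply: smul_local => k l ki lj; rewrite ?truncateE ?(smul_truncate _ _ (N := N)) //; lia.
rewrite -series_of_polyM mulrA series_of_polyM.
by apply: smul_local => k l ki lj; rewrite ?truncateE ?(smul_truncate _ _ (N := N)) //; lia.
Qed.

Lemma smul1 : left_id (sone R) (@smul R).
Proof.
move=> a; apply: seriesP => i j.
rewrite /smul !big_ord_recl /= /sone /= mul1r !subn0 !big1 ?addr0 //=.
- by move=> k _; rewrite big1 // => l _; rewrite /sone /= mul0r.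
- by move=> l _; rewrite /sone /= mul0r.
Qed.

Definition sadd (a b : S) : S := fun i j => a i j + b i j.
Definition sopp (a : S) : S := fun i j => - a i j.

Lemma saddA : associative sadd.
Proof. by move=> a b c; apply: seriesP => i j; rewrite /sadd addrA. Qed.
Lemma saddC : commutative sadd.
Proof. by move=> a b; apply: seriesP => i j; rewrite /sadd addrC. Qed.
Lemma sadd0 : left_id (szero R) sadd.
Proof. by move=> a; apply: seriesP => i j; rewrite /sadd add0r. Qed.
Lemma saddN : left_inverse (szero R) sopp sadd.
Proof. by move=> a; apply: seriesP => i j; rewrite /sadd addNr. Qed.
Lemma smulDl : left_distributive (@smul R) sadd.
Proof.
move=> a b c; apply: seriesP => i j; rewrite /smul /sadd -big_split /=.
apply: eq_bigr => k _; rewrite -big_split /=.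
by apply: eq_bigr => l _; rewrite mulrDl.
Qed.

HB.instance Definition _ := gen_eqMixin S.
HB.instance Definition _ := gen_choiceMixin S.
HB.instance Definition _ := GRing.isZmodule.Build S saddA saddC sadd0 saddN.

Lemma sone_neq0 : sone R != (0 : S).
Proof.
apply/eqP => /(congr1 (fun a : S => a 0%N 0%N)) /eqP.
by rewrite /sone /= oner_eq0.
Qed.

HB.instance Definition _ :=
  GRing.Zmodule_isComNzRing.Build S smulA smulC smul1 smulDl sone_neq0.

Lemma smulE (a b : S) : smul a b = a * b. Proof. by []. Qed.
Lemma soneE : sone R = 1. Proof. by []. Qed.
Lemma sexpE (a : S) n : sexp a n = a ^+ n.
Proof. by elim: n => [|n IH] //; rewrite exprS -IH. Qed.

Lemma coefsM (a b : S) i j :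
  (a * b) i j = \sum_(k < i.+1) \sum_(l < j.+1) a k l * b (i - k)%N (j - l)%N.
Proof. by []. Qed.
Lemma coefsD (a b : S) i j : (a + b) i j = a i j + b i j.
Proof. by []. Qed.
Lemma coefsN (a : S) i j : (- a) i j = - a i j.
Proof. by []. Qed.
Lemma coefs0 i j : (0 : S) i j = 0.
Proof. by []. Qed.
Lemma coefs1 i j : (1 : S) i j = ((i == 0%N) && (j == 0%N))%:R.
Proof. by []. Qed.

Lemma coefs_sum (I : Type) (r : seq I) (P : pred I) (F : I -> S) i j :
  (\sum_(k <- r | P k) F k) i j = \sum_(k <- r | P k) F k i j.
Proof.
by apply: (big_rec2 (fun (a : S) b => a i j = b)) => // k b a _ <-.
Qed.

Definition sconst (c : R[i]) : S :=
  fun i j => if (i == 0%N) && (j == 0%N) then c else 0.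

Lemma coefs_constM c (a : S) i j : (sconst c * a) i j = c * a i j.
Proof.
rewrite coefsM !big_ord_recl /= /sconst /= !subn0 !big1 ?addr0 //=.
- by move=> k _; rewrite big1 // => l _; rewrite mul0r.
- by move=> l _; rewrite mul0r.
Qed.

Definition sY : S := fun i j => ((i == 0%N) && (j == 1%N))%:R.

Lemma coefs_XM (a : S) i j : (sX R * a) i j = if i is i'.+1 then a i' j else 0.
Proof.
rewrite coefsM; case: i => [|i].
  by rewrite big_ord1 big1 // => l _; rewrite /sX /= mul0r.
rewrite !big_ord_recl /= /sX /= !subn0 /bump /= !mul0r !mul1r add0r.
rewrite !subSS !subn0 [X in X + _]big1 ?add0r; last by move=> l _; rewrite mul0r.
rewrite [X in _ + X]big1 ?addr0; last first.
  by move=> k _; rewrite big1 // => l _; rewrite mul0r.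
by rewrite big1 ?addr0 // => l _; rewrite mul0r.
Qed.

Definition sswap (a : S) : S := fun i j => a j i.

Lemma sswapK : involutive sswap. Proof. by []. Qed.

Lemma sswapM (a b : S) : sswap (a * b) = sswap a * sswap b.
Proof. by apply: seriesP => i j; rewrite /sswap !coefsM exchange_big. Qed.

Lemma sswapX : sswap (sX R) = sY.
Proof. by apply: seriesP => i j; rewrite /sswap /sX /sY andbC. Qed.

Lemma coefs_YM (a : S) i j : (sY * a) i j = if j is j'.+1 then a i j' else 0.
Proof. by rewrite -sswapX -[a]sswapK -sswapM /sswap coefs_XM. Qed.

Definition sdivX (a : S) : S := fun i j => a i.+1 j.

Lemma sdivXK (a : S) : (forall j, a 0%N j = 0) -> a = sX R * sdivX a.
Proof. by move=> a0; apply: seriesP => -[|i] j; rewrite coefs_XM ?a0. Qed.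

Lemma sX_inj : injective (fun a : S => sX R * a).
Proof.
move=> a b /= h; apply: seriesP => i j.
by have := congr1 (fun c : S => c i.+1 j) h; rewrite !coefs_XM.
Qed.

Lemma sY_inj : injective (fun a : S => sY * a).
Proof.
move=> a b /= h; apply: seriesP => i j.
by have := congr1 (fun c : S => c i j.+1) h; rewrite !coefs_YM.
Qed.

Lemma coefsM00 (a b : S) : (a * b) 0%N 0%N = a 0%N 0%N * b 0%N 0%N.
Proof. by rewrite coefsM !big_ord1. Qed.
Lemma coefsM10 (a b : S) :
  (a * b) 1%N 0%N = a 0%N 0%N * b 1%N 0%N + a 1%N 0%N * b 0%N 0%N.
Proof. by rewrite coefsM big_ord_recl !big_ord1. Qed.
Lemma coefsM01 (a b : S) :
  (a * b) 0%N 1%N = a 0%N 0%N * b 0%N 1%N + a 0%N 1%N * b 0%N 0%N.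
Proof. by rewrite coefsM big_ord1 big_ord_recl !big_ord1. Qed.

Lemma coefsM0 (a b : S) j :
  (a * b) 0%N j = \sum_(l < j.+1) a 0%N l * b 0%N (j - l)%N.
Proof. by rewrite coefsM big_ord1. Qed.

End SeriesRing.

(** * Pull-back by one blowup as a ring morphism *)

Section PullRing.
Variable R : realType.
Notation S := (series R).
Notation K := R[i].

(** The form of degree n of [a] read on the exceptional curve in the chart at [t], as a polynomial
    in v; it is the coefficient of u^n in the pull-back. *)
Definition homog (t : direction R) (n : nat) (a : S) : {poly K} :=
  \sum_(i < n.+1) a i (n - i)%N *: ((chart t).1 ^+ i * (chart t).2 ^+ (n - i)).

Lemma pull1E t (a : S) n l : pull1 t a n l = (homog t n a)`_l.
Proof. by []. Qed.

Lemma pull1_local t (a b : S) n l :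
  (forall i, (i <= n)%N -> a i (n - i)%N = b i (n - i)%N) ->
  pull1 t a n l = pull1 t b n l.
Proof.
move=> h; rewrite !pull1E; suff -> : homog t n a = homog t n b by [].
apply: eq_bigr => i _.
by rewrite h // -ltnS.
Qed.

(** On polynomials the blowup is an evaluation, so it is multiplicative by construction, and
    truncation carries this over to [pull1]. The outer indeterminate is x in the source and u in the
    target, the inner one y and v; [substY] treats the inner one. *)
Definition substY (t : direction R) : {poly K} -> {poly {poly K}} :=
  horner_morph (f := (@polyC {poly K}) \o (@polyC K))
   (fun a => mulrC ('X * ((chart t).2)%:P) (((@polyC {poly K}) \o (@polyC K)) a)).

HB.instance Definition _ t := GRing.RMorphism.on (substY t).

Definition subst (t : direction R) : {poly {poly K}} -> {poly {poly K}} :=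
  horner_morph (f := substY t)
   (fun a => mulrC ('X * ((chart t).1)%:P) (substY t a)).

HB.instance Definition _ t := GRing.RMorphism.on (subst t).

Lemma coef_subst t p n : (subst t p)`_n = homog t n (series_of_poly p).
Proof.
(* A common bound above n, the degree of [p] and those of its coefficients, so that both evaluations
   become sums over the same square. *)
pose N := (size p + \max_(i < size p) size (p`_i)%R + n.+1)%N.
have nN : (n < N)%N by rewrite /N leq_addl.
have hp : (size (map_poly (substY t) p) <= N)%N.
  by apply: leq_trans (size_poly _ _) _; rewrite /N -addnA leq_addr.
rewrite /subst /horner_morph (horner_coef_wide _ hp) coef_sum.
have hq i : (size (map_poly ((@polyC {poly K}) \o (@polyC K)) p`_i) <= N)%N.
  apply: leq_trans (size_poly _ _) _; rewrite /N.
  case: (ltnP i (size p)) => [ip|pi]; last by rewrite nth_default // size_poly0.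
  apply: leq_trans (leq_bigmax (Ordinal ip) (F := fun i : 'I_(size p) => size (p`_i)%R)) _.
  by rewrite addnAC leq_addl.
have e i j : ('X * ((chart t).2)%:P) ^+ j * ('X * ((chart t).1)%:P) ^+ i =
     (((chart t).1 ^+ i * (chart t).2 ^+ j)%:P : {poly {poly K}}) * 'X^(i + j).
  by rewrite !exprMn -!rmorphXn /= exprD polyCM; ring.
transitivity (\sum_(i < N) \sum_(j < N) if (i + j == n)%N then
    p`_i`_j *: ((chart t).1 ^+ i * (chart t).2 ^+ j) else 0).
  apply: eq_bigr => i _; rewrite coef_map_id0 ?rmorph0 //.
  rewrite /substY /horner_morph (horner_coef_wide _ (hq i)) mulr_suml coef_sum.
  apply: eq_bigr => j _; rewrite coef_map_id0 //= -mulrA e mulrA -polyCM coefCM coefXn.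
  by rewrite eq_sym; case: ifP => _; rewrite ?mulr1 ?mulr0 // mul_polyC.
rewrite /homog (big_ord_widen_cond N (fun _ => true)
  (fun i => series_of_poly p i (n - i)%N *: ((chart t).1 ^+ i * (chart t).2 ^+ (n - i)))) //.
rewrite [RHS]big_mkcond /=; apply: eq_bigr => i _.
case: ifP => hi.
  have hn : (n - i < N)%N by apply: leq_ltn_trans nN; apply: leq_subr.
  rewrite (bigD1 (Ordinal hn)) //= ifT; last by apply/eqP; lia.
  rewrite big1 ?addr0 // => j; rewrite -val_eqE /= => /eqP hj.
  by rewrite ifF //; apply/eqP; lia.
by rewrite big1 // => j _; rewrite ifF //; apply/eqP; lia.
Qed.

Lemma pull1_poly t p : pull1 t (series_of_poly p) = series_of_poly (subst t p).
Proof. by apply: seriesP => n l; rewrite pull1E /series_of_poly coef_subst. Qed.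

Lemma pull1_truncate t N (a : S) n l : (n < N)%N ->
  pull1 t (series_of_poly (truncate N a)) n l = pull1 t a n l.
Proof. by move=> nN; apply: pull1_local => i iN; rewrite truncateE //; lia. Qed.

Lemma pull1M t (a b : S) : pull1 t (a * b) = pull1 t a * pull1 t b.
Proof.
apply: seriesP => n l; pose N := n.+1.
transitivity (pull1 t (series_of_poly (truncate N a * truncate N b)) n l).
  apply: pull1_local => i iN; rewrite -smulE (smul_truncate _ _ (N := N)) //; rewrite /N; lia.
rewrite pull1_poly rmorphM /= series_of_polyM -!pull1_poly.
apply: smul_local => k l' kn _; apply: pull1_truncate; rewrite /N; lia.
Qed.

Lemma pull1D t (a b : S) : pull1 t (a + b) = pull1 t a + pull1 t b.
Proof.
apply: seriesP => n l; rewrite coefsD !pull1E -coefD.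
suff -> : homog t n (a + b) = homog t n a + homog t n b by [].
by rewrite /homog -big_split /=; apply: eq_bigr => i _; rewrite coefsD scalerDl.
Qed.

Lemma pull1_const t (c : K) : pull1 t (@sconst R c) = sconst c.
Proof.
apply: seriesP => -[|n] l; rewrite pull1E /homog /sconst /=.
  by rewrite big_ord1 /= !expr0 mulr1 coefZ coef1; case: eqP; rewrite ?mulr1 ?mulr0.
rewrite big1 ?coef0 // => -[[|i] hi] _ /=; rewrite ?subn0 scale0r //.
Qed.

Lemma sconst1 : @sconst R 1 = 1 :> S.
Proof. by apply: seriesP => i j; rewrite /sconst coefs1; case: ifP. Qed.
Lemma sconst0 : @sconst R 0 = 0 :> S.
Proof. by apply: seriesP => i j; rewrite /sconst; case: ifP. Qed.

Lemma pull11 t : pull1 t 1 = 1 :> S.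
Proof. by rewrite -sconst1 pull1_const. Qed.
Lemma pull10 t : pull1 t 0 = 0 :> S.
Proof. by rewrite -sconst0 pull1_const. Qed.

Lemma pull1N t (a : S) : pull1 t (- a) = - pull1 t a.
Proof. by apply/eqP; rewrite -addr_eq0 -pull1D addNr pull10. Qed.

Lemma pull1X t (a : S) n : pull1 t (a ^+ n) = pull1 t a ^+ n.
Proof. by elim: n => [|n IH]; rewrite ?expr0 ?pull11 // !exprS pull1M IH. Qed.

Lemma pull1_00 t (a : S) : pull1 t a 0%N 0%N = a 0%N 0%N.
Proof. by rewrite pull1E /homog big_ord1 /= !expr0 mulr1 coefZ coef1 mulr1. Qed.

Lemma pull1_0 t (a : S) l : a 0%N 0%N = 0 -> pull1 t a 0%N l = 0.
Proof. by move=> a0; rewrite pull1E /homog big_ord1 /= a0 scale0r coef0. Qed.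

Lemma pull1_1 t (a : S) l :
  pull1 t a 1%N l = a 0%N 1%N * (chart t).2`_l + a 1%N 0%N * (chart t).1`_l.
Proof. by rewrite pull1E /homog big_ord_recl big_ord1 /= !expr0 !mul1r !mulr1 coefD !coefZ. Qed.

Lemma pull1_big t (a : S) n l : a 0%N 0%N = 0 ->
  (forall i j, (1 < i + j)%N -> a i j = 0) -> (1 < n)%N -> pull1 t a n l = 0.
Proof.
move=> a0 ha n1; rewrite pull1E /homog big1 ?coef0 // => i _; rewrite ha ?scale0r //.
by have := ltn_ord i; lia.
Qed.

(** The second component Y_t(v) of the chart, as a series; [xfac] is the first, X_t(v). *)
Definition yfac (t : direction R) : S :=
  if t is Some c then sconst c + @sY R else 1.
Definition xfac (t : direction R) : S :=
  if t is Some c then 1 else @sY R.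

Lemma pull1_sX t : pull1 t (sX R) = sX R * xfac t.
Proof.
have hX i j : (1 < i + j)%N -> sX R i j = 0.
  by case: i => [|[|i]] //; case: j => [|j] //; rewrite /sX.
apply: seriesP => -[|[|n]] l; rewrite coefs_XM.
- by rewrite pull1_0.
- rewrite pull1_1 /sX /= mul0r mul1r add0r.
  by case: t => [c|] /=; rewrite ?coefs1 ?coef1 /sY ?coefX.
- by rewrite pull1_big //; case: t.
Qed.

Lemma pull1_sY t : pull1 t (@sY R) = sX R * yfac t.
Proof.
have hY i j : (1 < i + j)%N -> @sY R i j = 0.
  by case: i => [|[|i]] //; case: j => [|[|j]] //; rewrite /sY.
apply: seriesP => -[|[|n]] l; rewrite coefs_XM.
- by rewrite pull1_0.
- rewrite pull1_1 /sY /= mul0r mul1r addr0.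
  case: t => [c|] /=; rewrite ?coefs1 ?coef1 // coefsD coefD coefX coefC /sY /sconst /=.
  by [].
- by rewrite pull1_big //; case: t => [c|] //=; rewrite coefsD /sconst /sY /= addr0.
Qed.

End PullRing.

(** * Convergence *)

Section Convergence.
Variable R : realType.
Notation S := (series R).
Notation K := R[i].
Implicit Types (a b : S) (M N : K).

(** One constant, at least 1, absorbs both the bound and the inverse radius; such estimates survive
    enlarging the constant, so those of two series can be merged. *)
Lemma convergentP a :
  convergent a <-> exists2 M, 1 <= M & forall i j, `|a i j| <= M ^+ (i + j).+1.
Proof.
split=> [[r [M [r0 h]]]|[M M1 h]].
  have M0 : 0 <= M by apply: le_trans (h 0%N 0%N); rewrite expr0 mulr1.
  have ri0 : 0 <= r^-1 by rewrite invr_ge0 ltW.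
  exists (1 + M + r^-1) => [|i j]; first by rewrite -addrA lerDl addr_ge0.
  have : `|a i j| <= M * r^-1 ^+ (i + j).
    by rewrite exprVn ler_pdivlMr ?exprn_gt0.
  move=> /le_trans; apply; rewrite exprS ler_pM ?exprn_ge0 //.
    by rewrite addrAC lerDr addr_ge0.
  by apply: lerXn2r; rewrite ?nnegrE ?addr_ge0 // lerDr addr_ge0.
have M0 : 0 < M by apply: lt_le_trans M1; apply: ltr01.
exists M^-1, M; split=> [|i j]; first by rewrite invr_gt0.
by rewrite exprVn ler_pdivrMr ?exprn_gt0 // -exprS.
Qed.

Lemma convergentW a M N : 0 <= M -> M <= N ->
  (forall i j, `|a i j| <= M ^+ (i + j).+1) ->
  (forall i j, `|a i j| <= N ^+ (i + j).+1).
Proof.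
move=> M0 MN h i j; apply: le_trans (h i j) _.
by apply: lerXn2r; rewrite ?nnegrE // (le_trans M0).
Qed.

Lemma convergentD a b : convergent a -> convergent b -> convergent (a + b).
Proof.
move=> /convergentP[M M1 ha] /convergentP[N N1 hb]; apply/convergentP.
have M0 := le_trans ler01 M1; have N0 := le_trans ler01 N1.
exists (M + N) => [|i j]; first by rewrite -[1]addr0 lerD.
rewrite coefsD; apply: le_trans (ler_normD _ _) _.
apply: le_trans (lerD (ha i j) (hb i j)) _.
elim: (i + j)%N => [|n IH]; first by rewrite !expr1.
rewrite 3!(exprS _ n.+1) mulrDl; apply: lerD; apply: ler_wpM2l => //.
- by apply: le_trans IH; rewrite lerDl exprn_ge0.
- by apply: le_trans IH; rewrite lerDr exprn_ge0.
Qed.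

Lemma convergentN a : convergent a -> convergent (- a).
Proof.
by move=> [r [M [r0 h]]]; exists r, M; split=> // i j; rewrite coefsN normrN.
Qed.

Lemma leq_prod_expn i j : (i.+1 * j.+1 <= 2 ^ (i + j))%N.
Proof. by rewrite expnD leq_mul // ltn_expl. Qed.

Lemma convergentM a b : convergent a -> convergent b -> convergent (a * b).
Proof.
move=> /convergentP[M M1 ha] /convergentP[N N1 hb]; apply/convergentP.
have M0 := le_trans ler01 M1; have N0 := le_trans ler01 N1.
pose L := M + N; have L0 : 0 <= L by apply: addr_ge0.
have L1 : 1 <= L by rewrite /L -[1]addr0 lerD.
have {}ha : forall i j, `|a i j| <= L ^+ (i + j).+1.
  by apply: convergentW ha; rewrite // /L lerDl.
have {}hb : forall i j, `|b i j| <= L ^+ (i + j).+1.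
  by apply: convergentW hb; rewrite // /L lerDr.
(* There are (i+1)(j+1) terms, at most 2^(i+j), each bounded by L^(i+j+2), hence by L^(2(i+j+1)). *)
exists (2 * L ^+ 2) => [|i j].
  by rewrite mulr_ege1 ?exprn_ege1 ?ler1n.
rewrite coefsM; apply: le_trans (ler_norm_sum _ _ _) _.
apply: (@le_trans _ _ (\sum_(k < i.+1) \sum_(l < j.+1) L ^+ (i + j).+2)).
  apply: ler_sum => k _; apply: le_trans (ler_norm_sum _ _ _) _.
  apply: ler_sum => l _; rewrite normrM.
  apply: le_trans (ler_pM _ _ (ha _ _) (hb _ _)) _ => //;
    rewrite ?lerDl ?lerDr // -exprD.
  rewrite (_ : ((k + l).+1 + (i - k + (j - l)).+1)%N = (i + j).+2) //.
  by have := ltn_ord k; have := ltn_ord l; lia.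
under eq_bigr do rewrite sumr_const card_ord.
rewrite sumr_const card_ord -mulrnA exprMn -exprM -[leLHS]mulr_natl.
apply: ler_pM; rewrite ?exprn_ge0 ?ler0n //.
  rewrite -natrX ler_nat mulnC; apply: leq_trans (leq_prod_expn i j) _.
  by rewrite leq_exp2l.
by apply: ler_weXn2l => //; lia.
Qed.

Lemma convergent_const (c : K) : convergent (sconst c).
Proof.
exists 1, `|c|; split=> [|i j]; first exact: ltr01.
by rewrite expr1n mulr1 /sconst; case: ifP; rewrite ?normr0.
Qed.

Lemma convergent0 : convergent (0 : S).
Proof. by rewrite -sconst0; apply: convergent_const. Qed.
Lemma convergent1 : convergent (1 : S).
Proof. by rewrite -sconst1; apply: convergent_const. Qed.

Lemma convergentX a n : convergent a -> convergent (a ^+ n).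
Proof.
by move=> ha; elim: n => [|n IH]; [apply: convergent1 | rewrite exprS; apply: convergentM].
Qed.

Lemma convergent_sX : convergent (sX R).
Proof.
exists 1, 1; split=> [|i j]; first exact: ltr01.
by rewrite expr1n mulr1 /sX normr_nat lern1 leq_b1.
Qed.

Lemma convergent_swap a : convergent a -> convergent (sswap a).
Proof. by move=> [r [M [r0 h]]]; exists r, M; split=> // i j; rewrite addnC; apply: h. Qed.

Lemma convergent_sY : convergent (@sY R).
Proof. by rewrite -sswapX; apply/convergent_swap/convergent_sX. Qed.

Lemma convergent_divX a : convergent a -> convergent (sdivX a).
Proof.
move=> [r [M [r0 h]]]; exists r, (M * r^-1); split=> // i j.
by rewrite ler_pdivlMr // -mulrA -exprSr -addSn; apply: h.
Qed.

Lemma coef_chart_exp_le (c : K) m l :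
  `|((c%:P + 'X) ^+ m)`_l| <= (1 + `|c|) ^+ m.
Proof.
have c0 : 0 <= 1 + `|c| by rewrite addr_ge0.
elim: m l => [|m IH] l.
  by rewrite !expr0 coef1 normr_nat lern1 leq_b1.
rewrite exprS mulrDl coefD coefCM coefXM.
apply: le_trans (ler_normD _ _) _; rewrite normrM exprS addrC mulrDl mul1r.
apply: lerD; last by rewrite ler_wpM2l.
by case: (l == _); rewrite ?normr0 ?exprn_ge0.
Qed.

Lemma convergent_pull1 t a : convergent a -> convergent (pull1 t a).
Proof.
move=> /convergentP[M M1 h]; apply/convergentP.
have M0 := le_trans ler01 M1.
pose c : K := if t is Some c then 1 + `|c| else 1.
have c1 : 1 <= c by rewrite /c; case: (t) => // c'; rewrite lerDl.
have c0 := le_trans ler01 c1.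
have hc i j l : `|((chart t).1 ^+ i * (chart t).2 ^+ j)`_l| <= c ^+ (i + j).
  rewrite /c; case: (t) => [c'|] /=.
    rewrite expr1n mul1r; apply: le_trans (coef_chart_exp_le _ _ _) _.
    by rewrite ler_weXn2l ?lerDl // leq_addl.
  by rewrite !expr1n mulr1 coefXn normr_nat lern1 leq_b1.
(* The factor 2 pays for the n+1 monomials of degree n, and [c] for the coefficients of X_t^i
   Y_t^(n-i). *)
exists (2 * (M * c)) => [|n l].
  by rewrite !mulr_ege1 ?ler1n.
rewrite pull1E /homog coef_sum; apply: le_trans (ler_norm_sum _ _ _) _.
apply: (@le_trans _ _ (\sum_(i < n.+1) (M * c) ^+ n.+1)).
  apply: ler_sum => i _; rewrite coefZ normrM.
  apply: le_trans (ler_pM _ _ (h _ _) (hc _ _ _)) _ => //.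
  rewrite subnKC -1?ltnS // exprMn ler_wpM2l ?exprn_ge0 //.
  by rewrite ler_weXn2l.
rewrite sumr_const card_ord.
apply: (@le_trans _ _ ((2 * (M * c)) ^+ n.+1)); last first.
  rewrite ler_weXn2l ?ltnS ?leq_addr //.
  by rewrite !mulr_ege1 ?ler1n.
rewrite -[leLHS]mulr_natl [leRHS]exprMn ler_wpM2r ?exprn_ge0 ?mulr_ge0 //.
by rewrite -natrX ler_nat; apply: ltnW; apply: ltn_expl.
Qed.

Lemma sum_expr4 (F : numFieldType) n : \sum_(k < n) (4^-1 : F) ^+ k <= 4 / 3.
Proof.
have e : (1 - 4^-1 : F) = 3 / 4 by field.
have p3 : (0 : F) < 3 / 4 by rewrite divr_gt0 ?ltr0n.
rewrite -(ler_pM2l p3) -{1}e.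
have -> : (3 / 4 * (4 / 3) : F) = 1 by field.
rewrite -opprB mulNr -subrX1 opprB lerBlDr lerDl exprn_ge0 // invr_ge0 ler0n.
by [].
Qed.

Lemma sum2_split (V : nmodType) (F : nat -> nat -> V) i j :
  \sum_(k < i.+1) \sum_(l < j.+1) F k l = F 0%N 0%N +
  \sum_(k < i.+1) \sum_(l < j.+1) (if (k + l == 0)%N then 0 else F k l).
Proof.
rewrite [in LHS]big_ord_recl [X in X + _ = _]big_ord_recl.
rewrite [in RHS]big_ord_recl [X in _ = _ + (X + _)]big_ord_recl /= add0r addrA.
congr (_ + _ + _).
Qed.

(** The geometric series for 1 / (1 - (1 - a)). When [a] has constant term 1, the power (1 - a)^m
    has no term of degree below m, so the finite sum is exact in degree i + j. *)
Definition sinv (a : S) : S :=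
  fun i j => (\sum_(m < (i + j).+1) (1 - a) ^+ m) i j.

Lemma coefs_exp_small a n i j : a 0%N 0%N = 0 -> (i + j < n)%N ->
  (a ^+ n) i j = 0.
Proof.
move=> a0; elim: n i j => [|n IH] i j // hij; rewrite exprS coefsM.
apply: big1 => -[k hk] _; apply: big1 => -[l hl] _ /=.
case: (posnP (k + l)) => h.
  have k0 : k = 0%N by clear -h; lia.
  have l0 : l = 0%N by clear -h; lia.
  by rewrite k0 l0 a0 mul0r.
have hlt : (i - k + (j - l) < n)%N by clear -h hij hk hl; lia.
by rewrite (IH _ _ hlt) mulr0.
Qed.

Lemma mul_sinv a : a 0%N 0%N = 1 -> a * sinv a = 1.
Proof.
move=> a0; have n0 : (1 - a) 0%N 0%N = 0 by rewrite coefsD coefsN a0 coefs1 subrr.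
have trunc (N : nat) i j : (i + j < N)%N -> sinv a i j = (\sum_(m < N) (1 - a) ^+ m) i j.
  move=> hN; rewrite /sinv !coefs_sum (big_ord_widen _ (fun m => ((1 - a) ^+ m) i j) hN).
  rewrite big_mkcond; apply: eq_bigr => m _; case: ifP => // /negbT.
  by rewrite -leqNgt => hm; rewrite coefs_exp_small.
apply: seriesP => i j; pose N : nat := (i + j).+1.
transitivity ((a * \sum_(m < N) (1 - a) ^+ m) i j).
  by apply: smul_local => k l ki lj //; apply: trunc; rewrite /N; lia.
have -> : a * \sum_(m < N) (1 - a) ^+ m = 1 - (1 - a) ^+ N.
  by rewrite -[RHS]opprB subrX1; ring.
by rewrite coefsD coefsN coefs_exp_small // subr0.
Qed.

(** Strong induction on the degree, with the bound (4 M^2)^(i+j), along the recursion that expresses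
    a coefficient of the inverse by those of lower degree. For k + l > 0, the coefficient of index
    (k, l) of [a] is at most M^(2(k+l)), which gains a factor 4^-(k+l). The double geometric sum is
    at most (4/3)^2, hence at most 2, and dropping its term of index (0, 0) leaves at most 1. *)
Lemma convergent_sinv a : a 0%N 0%N = 1 -> convergent a -> convergent (sinv a).
Proof.
move=> a0 /convergentP[M M1 h].
have M0 := le_trans ler01 M1.
have L0 : 0 < 4 * M ^+ 2 :> K by rewrite mulr_gt0 ?ltr0n ?exprn_gt0 // (lt_le_trans ltr01).
exists (4 * M ^+ 2)^-1, 1; split=> [|i j]; first by rewrite invr_gt0.
rewrite exprVn ler_pdivrMr ?exprn_gt0 // mul1r.
have [n] := ubnP (i + j); elim: n i j => // n IH i j hij.
case: (posnP (i + j)) => h0.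
  have [-> ->] : i = 0%N /\ j = 0%N by lia.
  by rewrite /sinv big_ord1 expr0 coefs1 /= normr1 expr0.
have e : sinv a i j = - \sum_(k < i.+1) \sum_(l < j.+1)
    (if (k + l == 0)%N then 0 else a k l * sinv a (i - k)%N (j - l)%N).
  apply/eqP; rewrite -addr_eq0; apply/eqP.
  transitivity ((a * sinv a) i j).
    by rewrite coefsM (sum2_split (fun k l => a k l * sinv a (i - k)%N (j - l)%N)) a0 mul1r !subn0.
  rewrite mul_sinv // coefs1; suff -> : (i == 0%N) && (j == 0%N) = false by [].
  by clear -h0; lia.
rewrite {}e normrN; apply: le_trans (ler_norm_sum _ _ _) _.
have M2 : 0 <= 4 * M ^+ 2 by apply: ltW.
pose T (k l : nat) : K := (4 * M ^+ 2) ^+ (i + j) * (4^-1 ^+ k * 4^-1 ^+ l).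
have T0 k l : 0 <= T k l by rewrite !mulr_ge0 ?exprn_ge0 ?invr_ge0 ?ler0n.
apply: (@le_trans _ _ (\sum_(k < i.+1) \sum_(l < j.+1)
   (if (k + l == 0)%N then 0 else T k l))).
  apply: ler_sum => -[k hk] _; apply: le_trans (ler_norm_sum _ _ _) _.
  apply: ler_sum => -[l hl] _ /=; case: eqP => kl; first by rewrite normr0.
  rewrite normrM; apply: le_trans (ler_pM _ _ (h _ _) (IH _ _ _)) _ => //; first by lia.
  have -> : T k l = (M ^+ 2) ^+ (k + l) * (4 * M ^+ 2) ^+ (i - k + (j - l)).
    have eij : (i + j = (k + l) + (i - k + (j - l)))%N by lia.
    rewrite /T eij -(exprD 4^-1) exprD mulrAC; congr (_ * _).
    by rewrite -exprMn mulrAC mulfV ?mul1r ?pnatr_eq0.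
  rewrite ler_wpM2r ?exprn_ge0 // -exprM ler_weXn2l //; lia.
have e := sum2_split T i j.
have T00 : T 0%N 0%N = (4 * M ^+ 2) ^+ (i + j) by rewrite /T !expr0 !mulr1.
rewrite -(lerD2l (T 0%N 0%N)) -e /T.
under eq_bigr do rewrite -big_distrr /= -big_distrr /=.
rewrite -big_distrr -big_distrl /= !expr0 !mulr1 -{2 3}[_ ^+ (i + j)]mulr1 -mulrDr.
rewrite ler_wpM2l ?exprn_ge0 //.
apply: (@le_trans _ _ (4 / 3 * (4 / 3))).
  by apply: ler_pM; rewrite ?sum_expr4 // sumr_ge0 // => *; rewrite exprn_ge0 // invr_ge0 ler0n.
rewrite mulf_div ler_pdivrMr ?mulr_gt0 ?ltr0n //.
by rewrite -[1 + 1]/(2%:R : K) -!natrM ler_nat.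
Qed.

Lemma convergent_inverse a : convergent a -> a 0%N 0%N != 0 ->
  exists2 b, convergent b & a * b = 1.
Proof.
move=> ha a0; pose c := sconst (a 0%N 0%N)^-1.
have cc : convergent c by apply: convergent_const.
have h1 : (c * a) 0%N 0%N = 1 by rewrite coefs_constM mulVf.
exists (c * sinv (c * a)); last by rewrite mulrCA mulrA mul_sinv.
by apply: convergentM => //; apply: convergent_sinv => //; apply: convergentM.
Qed.

Lemma sunitP a : sunit a <-> convergent a /\ a 0%N 0%N != 0.
Proof.
split=> [[ca [b _]]|[ca a0]]; last by split=> //; apply: convergent_inverse.
rewrite smulE soneE => /(congr1 (fun a : S => a 0%N 0%N)).
rewrite coefsM00 coefs1 /= => h; split=> //; apply/eqP => a0.
by move/eqP: h; rewrite a0 mul0r eq_sym oner_eq0.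
Qed.

End Convergence.

(** * Smooth branches and their strict transforms *)

Ltac cv := repeat first [ assumption | match goal with
  | |- convergent (_ * _) => apply: convergentM
  | |- convergent (_ + _) => apply: convergentD
  | |- convergent (- _) => apply: convergentN
  | |- convergent (_ ^+ _) => apply: convergentX
  | |- convergent (sconst _) => apply: convergent_const
  | |- convergent 0 => apply: convergent0
  | |- convergent 1 => apply: convergent1
  | |- convergent (sX _) => apply: convergent_sX
  | |- convergent (sY _) => apply: convergent_sY
  | |- convergent (pull1 _ _) => apply: convergent_pull1
  | |- convergent (sdivX _) => apply: convergent_divX
  end ].

Section Branches.
Variable R : realType.
Notation S := (series R).
Notation K := R[i].
Implicit Types (a b e f g h w : S) (I J : set S) (t : direction R).

Definition smooth f : Prop :=
  [/\ convergent f, f 0%N 0%N = 0 & f 1%N 0%N != 0 \/ f 0%N 1%N != 0].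

Lemma smooth_convergent f : smooth f -> convergent f. Proof. by case. Qed.

Lemma ideal_self f : ideal f f.
Proof. by exists 1; [cv | rewrite smulE mulr1]. Qed.

Lemma ideal_mulr f h w : convergent w -> ideal f h -> ideal f (h * w).
Proof. by move=> cw [v cv' ->]; exists (v * w); [cv | rewrite !smulE mulrA]. Qed.

Lemma ideal_mull f h w : convergent w -> ideal f h -> ideal f (w * h).
Proof. by rewrite mulrC; apply: ideal_mulr. Qed.

Lemma ideal_mem f w : convergent w -> ideal f (f * w).
Proof. by move=> cw; apply: ideal_mulr => //; apply: ideal_self. Qed.

Lemma ideal_sub f g : ideal f g -> ideal g `<=` ideal f.
Proof. by move=> fg h [w cw ->]; apply: ideal_mulr. Qed.

Lemma ideal_unit f w : convergent w -> w 0%N 0%N != 0 -> ideal (f * w) = ideal f.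
Proof.
move=> cw w0; have [v cv' e] := convergent_inverse cw w0.
apply/seteqP; split; apply: ideal_sub; first exact: ideal_mem.
by exists v => //; rewrite smulE -mulrA e mulr1.
Qed.

Lemma smooth_neq0 f : smooth f -> f <> 0.
Proof. by case=> _ _ h f0; case: h; rewrite f0 coefs0 eqxx. Qed.

(** A product of two series without constant term has no linear part. *)
Lemma smooth_irreducible f : smooth f -> sirreducible f.
Proof.
move=> sf; have [cf f00 f1] := sf; split=> //; first exact: smooth_neq0.
  by move=> /sunitP[_]; rewrite f00 eqxx.
move=> a b ca cb; rewrite smulE => e.
have [a0|a0] := eqVneq (a 0%N 0%N) 0; last by left; apply/sunitP.
have [b0|b0] := eqVneq (b 0%N 0%N) 0; last by right; apply/sunitP.
by case: f1; rewrite e ?coefsM10 ?coefsM01 a0 b0 mul0r mulr0 addr0 eqxx.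
Qed.

Lemma smooth_branch f : smooth f -> is_branch (ideal f).
Proof. by exists f => //; apply: smooth_irreducible. Qed.

Lemma branch_proper I u : is_branch I -> convergent u -> u 0%N 0%N != 0 -> ~ I u.
Proof.
move=> [f [cf _ nu _] ->] cu u0 [w cw e]; apply: nu; apply/sunitP; split=> //.
by apply: contraNneq u0 => f0; rewrite e smulE coefsM00 f0 mul0r.
Qed.

(** A generator of [I] divides [f]; as [f] is irreducible and the generator is not a unit, the
    cofactor is a unit. To identify a branch it thus suffices to find one smooth series in it. *)
Lemma branch_smooth I f : is_branch I -> I f -> smooth f -> I = ideal f.
Proof.
move=> [g [cg _ nu _] ->] [w cw e] /smooth_irreducible[_ _ _ /(_ g w cg cw e)[//|]].
by move=> /sunitP[_ w0]; rewrite e smulE ideal_unit.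
Qed.

Lemma branch_mulr I h w : is_branch I -> convergent w -> I h -> I (h * w).
Proof. by move=> [f _ ->]; apply: ideal_mulr. Qed.

Lemma smooth_sX : smooth (sX R).
Proof. by split; [cv | | left; rewrite /sX /= oner_eq0]. Qed.

Lemma smooth_sY : smooth (@sY R).
Proof. by split; [cv | | right; rewrite /sY /= oner_eq0]. Qed.

Definition prime_series e := forall a b h, convergent a -> convergent b ->
  e * h = a * b -> (exists2 c, convergent c & a = e * c) \/
                   (exists2 c, convergent c & b = e * c).

(** Restrict to x = 0: if neither restriction vanishes, their lowest terms y^m and y^n multiply to a
    nonzero coefficient of y^(m+n), whereas the product is divisible by x. *)
Lemma sX_prime : prime_series (sX R).
Proof.
move=> a b h ca cb eab.
have [a0|/existsNP[m0 /eqP am0]] := pselect (forall j, a 0%N j = 0).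
  by left; exists (sdivX a); [cv | apply: sdivXK].
have [b0|/existsNP[n0 /eqP bn0]] := pselect (forall j, b 0%N j = 0).
  by right; exists (sdivX b); [cv | apply: sdivXK].
case: (ex_minnP (ex_intro (fun m => a 0%N m != 0) m0 am0)) => m am mmin.
case: (ex_minnP (ex_intro (fun m => b 0%N m != 0) n0 bn0)) => n bn nmin.
have := congr1 (fun c : S => c 0%N (m + n)%N) eab.
rewrite coefs_XM coefsM0 (bigD1 (inord m)) //= big1 ?addr0.
  rewrite inordK ?ltnS ?leq_addr // addKn => /esym/eqP.
  by rewrite mulf_eq0 (negPf am) (negPf bn).
move=> l; rewrite -val_eqE /= inordK ?ltnS ?leq_addr // => lm.
have [lt_lm|le_ml] := ltnP l m.
  have [->|al] := eqVneq (a 0%N l) 0; first by rewrite mul0r.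
  by have := mmin _ al; rewrite leqNgt lt_lm.
have [->|al] := eqVneq (b 0%N (m + n - l)%N) 0; first by rewrite mulr0.
by have := nmin _ al; have := ltn_ord l; move: lm le_ml; clear; lia.
Qed.

Lemma sY_prime : prime_series (@sY R).
Proof.
move=> a b h ca cb /(congr1 (@sswap R)).
rewrite !sswapM -sswapX sswapK => /sX_prime.
case; [exact: convergent_swap.. | | ] => -[c cc e]; [left|right]; exists (sswap c);
  by [apply: convergent_swap | rewrite -[LHS]sswapK e sswapM].
Qed.

(** [e] is a nonzerodivisor modulo [I]. Instead of the primality of the ideal of a branch, only this
    is established, factor by factor, for units and coordinates. *)
Definition peelable I e := forall h, convergent h -> I (e * h) -> I h.

(** If [e] divides the generator of [I], irreducibility gives I = (e), which is excluded; so it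
    divides the cofactor and can be cancelled. *)
Lemma peelable_prime I e : is_branch I -> smooth e -> prime_series e ->
  injective (fun a => e * a) -> I <> ideal e -> peelable I e.
Proof.
move=> [g ig ->] se pe inj ne h ch [w cw]; have [cg _ nug irr] := ig.
rewrite smulE => e1; have [[c cc e2]|[c cc e2]] := pe _ _ _ cg cw e1.
  case: (irr _ _ (smooth_convergent se) cc e2) => /sunitP[_ u0].
    by case: se u0 => _ ->; rewrite eqxx.
  by case: ne; rewrite e2 ideal_unit.
exists c => //; apply: inj; rewrite /= e1 e2 smulE; ring.
Qed.

Lemma peelable_sX I : is_branch I -> I <> ideal (sX R) -> peelable I (sX R).
Proof.
move=> bI; apply: peelable_prime => //; [apply: smooth_sX | apply: sX_prime | apply: sX_inj].
Qed.

Lemma peelable_sY I : is_branch I -> I <> ideal (@sY R) -> peelable I (@sY R).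
Proof.
move=> bI; apply: peelable_prime => //; [apply: smooth_sY | apply: sY_prime | apply: sY_inj].
Qed.

Lemma peelable_unit I u : is_branch I -> convergent u -> u 0%N 0%N != 0 ->
  peelable I u.
Proof.
move=> bI cu u0 h ch; have [v cv' e] := convergent_inverse cu u0.
by move=> /(branch_mulr bI cv'); rewrite mulrAC e mul1r.
Qed.

Lemma peelable1 I : peelable I 1.
Proof. by move=> h _; rewrite mul1r. Qed.

Lemma peelableM I a b : convergent b -> peelable I a -> peelable I b ->
  peelable I (a * b).
Proof. by move=> cb pa pb h ch; rewrite -mulrA => /pa/pb; apply; cv. Qed.

Lemma peelableX I a n : convergent a -> peelable I a -> peelable I (a ^+ n).
Proof.
move=> ca pa; elim: n => [|n IH]; first exact: peelable1.
by rewrite exprS; apply: peelableM => //; cv.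
Qed.

Definition tangent t f : Prop := pull1 t f 1%N 0%N = 0.
Definition strict t f : S := sdivX (pull1 t f).

Lemma tangentE t f :
  tangent t f <-> (if t is Some c then f 0%N 1%N * c + f 1%N 0%N else f 0%N 1%N) = 0.
Proof.
rewrite /tangent pull1_1; case: t => [c|] /=.
  rewrite coefD coefC coefX coef1 /= addr0 mulr1. by [].
by rewrite coefX coef1 /= mulr1 mulr0 addr0.
Qed.

Lemma smooth_tangent f : smooth f -> exists t, tangent t f.
Proof.
move=> [_ _ f1]; have [f0|f0] := eqVneq (f 0%N 1%N) 0.
  by exists None; apply/tangentE.
exists (Some (- (f 0%N 1%N)^-1 * f 1%N 0%N)); apply/tangentE.
by rewrite mulNr mulrN mulrA mulfV // mul1r addNr.
Qed.

Lemma tangent_det t f g : tangent t f -> tangent t g ->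
  f 1%N 0%N * g 0%N 1%N - f 0%N 1%N * g 1%N 0%N = 0.
Proof.
move=> /tangentE hf /tangentE; case: t hf => [c|] hf hg; last by rewrite hf hg mulr0 mul0r subrr.
rewrite -(subr0 (f 1%N 0%N)) -{1}hf -(subr0 (g 1%N 0%N)) -{1}hg.
by rewrite !opprD [f 1%N 0%N + _]addrC subrK [g 1%N 0%N + _]addrC subrK; ring.
Qed.

Lemma tangent_uniq t t' f : smooth f -> tangent t f -> tangent t' f -> t = t'.
Proof.
move=> [_ _ f1] /tangentE h /tangentE.
have nz : f 0%N 1%N = 0 -> f 1%N 0%N = 0 -> False.
  by move=> a b; case: f1; rewrite ?a ?b eqxx.
case: t h => [c|]; case: t' => [c'|] //.
- move=> h h'; congr Some; apply/eqP; rewrite -subr_eq0.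
  have /eqP : f 0%N 1%N * (c - c') = 0.
    by rewrite mulrBr -[X in X - _](addrK (f 1%N 0%N)) h sub0r -opprD addrC h' oppr0.
  rewrite mulf_eq0 => /orP[/eqP f0|//].
  by case: nz => //; move: h; rewrite f0 mul0r add0r.
- by move=> h f0; case: nz => //; move: h; rewrite f0 mul0r add0r.
- by move=> f0 h; case: nz => //; move: h; rewrite f0 mul0r add0r.
Qed.

Lemma strictE t f : f 0%N 0%N = 0 -> pull1 t f = sX R * strict t f.
Proof. by move=> f0; apply: sdivXK => j; apply: pull1_0. Qed.

Lemma strict_unit t f : ~ tangent t f -> strict t f 0%N 0%N != 0.
Proof. by move=> /eqP. Qed.

Lemma convergent_strict t f : convergent f -> convergent (strict t f).
Proof. by move=> cf; rewrite /strict; cv. Qed.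

(** This coefficient expresses that the strict transform is smooth and transversal to the
    exceptional curve {u = 0}. *)
Lemma strict_01 t f : smooth f -> tangent t f -> strict t f 0%N 1%N != 0.
Proof.
move=> [cf f0 f1] /tangentE h; rewrite /strict /sdivX pull1_1.
case: t h => [c|] /= h.
  rewrite coef1 coefD coefC coefX /= add0r mulr0 addr0 mulr1.
  apply/eqP => h0; move: h; rewrite h0 mul0r add0r => h1.
  by case: f1; rewrite ?h0 ?h1 eqxx.
rewrite coef1 coefX /= mulr0 add0r mulr1.
by case: f1 => //; rewrite h eqxx.
Qed.

Lemma smooth_strict t f : smooth f -> tangent t f -> smooth (strict t f).
Proof.
move=> sf tf; split; first by apply: convergent_strict; case: sf.
  exact: tf.
by right; apply: strict_01.
Qed.

Lemma strict_neq_sX t f : smooth f -> tangent t f -> ideal (strict t f) <> ideal (sX R).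
Proof.
move=> sf tf e; have := ideal_self (strict t f); rewrite e => -[w cw].
move=> /(congr1 (fun a : S => a 0%N 1%N)); rewrite smulE coefs_XM.
by move/eqP; rewrite (negPf (strict_01 sf tf)).
Qed.

(** The definition only asks [J] to be a branch, other than the exceptional one, containing all
    pull-backs. Cancelling u puts [strict t f] in [J]; if [t] is not tangent to [f] this series is a
    unit, which no branch contains, and otherwise it is smooth and generates [J]. *)
Lemma strict_transformP t f J : smooth f ->
  strict_transform t (ideal f) J <-> tangent t f /\ J = ideal (strict t f).
Proof.
move=> sf; have [cf f0 _] := sf; have cs := convergent_strict t cf.
split=> [[bJ nJ h]|[tf ->]].
  have : J (strict t f).
    by apply: (peelable_sX bJ nJ cs); rewrite -strictE //; apply: h; apply: ideal_self.
  have [tf|ntf] := pselect (tangent t f).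
    by move=> Js; split=> //; apply: branch_smooth => //; apply: smooth_strict.
  by move/(branch_proper bJ cs (strict_unit ntf)).
split; [by apply: smooth_branch; apply: smooth_strict | exact: strict_neq_sX |].
move=> h [w cw ->]; rewrite smulE pull1M strictE // -mulrA mulrCA.
by apply: ideal_mem; cv.
Qed.

(** A class containing the smooth series and stable under blowups: a unit, a monomial in the local
    coordinates, and at most one more smooth factor. It controls pull-backs of branches of crosses
    to all infinitely near points. *)
Definition decomposable (F : S) : Prop := exists w n m h,
  [/\ convergent w, w 0%N 0%N != 0, h = 1 \/ smooth h &
      F = w * sX R ^+ n * @sY R ^+ m * h].

Lemma decomposable_smooth f : smooth f -> decomposable f.
Proof.
move=> sf; exists 1, 0%N, 0%N, f; split; [cv | | by right | by rewrite !expr0 !mul1r].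
by rewrite coefs1 oner_eq0.
Qed.

Lemma coefs00X a n : (a ^+ n) 0%N 0%N = a 0%N 0%N ^+ n.
Proof. by elim: n => [|n IH]; rewrite ?expr0 ?coefs1 // !exprS coefsM00 IH. Qed.

Lemma convergent_yfac t : convergent (yfac t).
Proof. by case: t => [c|] /=; cv. Qed.
Lemma convergent_xfac t : convergent (xfac t).
Proof. by case: t => [c|] /=; cv. Qed.

Lemma pull1_decomposable_factor t h : h = 1 \/ smooth h ->
  exists w n h', [/\ convergent w, w 0%N 0%N != 0, h' = 1 \/ smooth h' &
    pull1 t h = w * sX R ^+ n * h'].
Proof.
move=> [->|sh].
  exists 1, 0%N, 1; split; rewrite ?coefs1 ?oner_eq0 ?expr0 ?mulr1 ?pull11 //; cv.
  by left.
have [ch h0 _] := sh; rewrite strictE //.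
have [th|nth] := pselect (tangent t h).
  exists 1, 1%N, (strict t h); split; rewrite ?coefs1 ?oner_eq0 ?expr1 ?mul1r //; cv.
  by right; apply: smooth_strict.
exists (strict t h), 1%N, 1; split; rewrite ?expr1 ?mulr1 //.
- exact: convergent_strict.
- exact: strict_unit.
- by left.
- by rewrite mulrC.
Qed.

Lemma xyfac t n m : exists w k l, [/\ convergent w, w 0%N 0%N != 0 &
  xfac t ^+ n * yfac t ^+ m = w * sX R ^+ k * @sY R ^+ l].
Proof.
have c1 : (1 : S) 0%N 0%N != 0 by rewrite coefs1 oner_eq0.
case: t => [c|] /=; last first.
  by exists 1, 0%N, n; split; [cv | | rewrite !expr1n expr0; ring].
have [->|c0] := eqVneq c 0.
  by exists 1, 0%N, m; split; [cv | | rewrite sconst0 add0r !expr1n expr0; ring].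
exists (yfac (Some c) ^+ m), 0%N, 0%N; split; first by apply: convergentX (convergent_yfac _).
  by rewrite coefs00X expf_neq0 // /= coefsD /sconst /sY /= addr0.
by rewrite /= !expr1n !expr0; ring.
Qed.

Lemma decomposable_pull1 t F : decomposable F -> decomposable (pull1 t F).
Proof.
move=> [w [n [m [h [cw w0 hh ->]]]]].
have [w1 [k1 [h1 [cw1 w10 hh1 e1]]]] := pull1_decomposable_factor t hh.
have [w2 [k2 [l2 [cw2 w20 e2]]]] := xyfac t n m.
exists (pull1 t w * w1 * w2), (n + m + k1 + k2)%N, l2, h1; split => //; first by cv.
  by rewrite !coefsM00 pull1_00 !mulf_neq0.
rewrite !pull1M !pull1X pull1_sX pull1_sY e1 !exprMn !exprD.
set x := sX R in e2 *; set y := @sY R in e2 *.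
transitivity (pull1 t w * w1 * x ^+ n * x ^+ m * x ^+ k1 * h1 * (xfac t ^+ n * yfac t ^+ m)).
  by ring.
by rewrite e2; ring.
Qed.

(* For an arbitrary F this requires unique factorization in C{x, y}; the explicit
   shape of F only requires that x and y be prime. *)
Lemma branch_pull1 t F I : decomposable F -> is_branch I -> I (pull1 t F) ->
  I = ideal (sX R) \/
  exists f, [/\ smooth f, ideal f F & strict_transform t (ideal f) I].
Proof.
move=> [w [n [m [h [cw w0 hh ->]]]]] bI hI.
have ch : convergent h by case: hh => [->|[]//]; cv.
have [->|nX] := pselect (I = ideal (sX R)); first by left.
right; have pX := peelable_sX bI nX.
have cxf := convergent_xfac t; have cyf := convergent_yfac t.
have := peelableM (_ : convergent (sX R ^+ (n + m)))
  (peelable_unit bI (convergent_pull1 t cw) _) (peelableX (n := n + m) (convergent_sX R) pX).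
rewrite pull1_00 => /(_ (convergentX _ (convergent_sX R)) w0) peel.
have peel0 := peel (xfac t ^+ n * (yfac t ^+ m * pull1 t h)).
rewrite !pull1M !pull1X pull1_sX pull1_sY in hI.
have {peel peel0 hI} : I (xfac t ^+ n * (yfac t ^+ m * pull1 t h)).
  apply: peel0; first by cv.
  move: hI; rewrite !exprMn exprD.
  set A := pull1 t w; set B := sX R ^+ n; set D := sX R ^+ m.
  by rewrite (_ : A * (B * _) * _ * _ =
    A * (B * D) * (xfac t ^+ n * (yfac t ^+ m * pull1 t h))) //; ring.
have strict_eq f g : f 0%N 0%N = 0 -> pull1 t f = sX R * g -> strict t f = g.
  by move=> f0 fg; apply: sX_inj; rewrite /= -strictE.
(* A factor that cannot be cancelled is the one that cuts out [I]. Here X_t is neither 1 nor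
   cancellable, so [t] is the direction (0 : 1), X_t = v, and [I] is the strict transform of {x =
   0}. *)
have [px|] := pselect (peelable I (xfac t ^+ n)); last first.
  case: n => [|n]; first by move=> []; rewrite expr0; apply: peelable1.
  move=> npx; exists (sX R).
  have tN : t = None.
    by case: (t) npx => // c []; apply: peelableX; [exact: convergent1 | apply: peelable1].
  rewrite tN in npx strict_eq *.
  have -> : I = ideal (@sY R).
    apply: contrapT => nY; apply: npx.
    by apply: peelableX; [exact: convergent_sY | exact: peelable_sY].
  split; [exact: smooth_sX | |].
    by rewrite exprS mulrCA -!mulrA; apply: ideal_mem; cv.
  apply/strict_transformP; first exact: smooth_sX.
  by split; [apply/tangentE | rewrite (strict_eq _ (@sY R)) // pull1_sX].
move=> /px{px} => /(_ (convergentM (convergentX _ cyf) (convergent_pull1 _ ch))).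
(* Likewise Y_t must be v, so [t] is the direction (1 : 0) and [I] is the strict transform of {y =
   0}. If both powers cancel, only the smooth factor [h] remains. *)
have [py|] := pselect (peelable I (yfac t ^+ m)); last first.
  case: m => [|m]; first by move=> []; rewrite expr0; apply: peelable1.
  move=> npy _; exists (@sY R).
  have tN : t = Some 0.
    case: (t) npy => [c|] npy; last first.
      by case: npy; apply: peelableX; [exact: convergent1 | apply: peelable1].
    congr Some; apply/eqP; apply: contrapT => /negP c0; case: npy.
    apply: peelableX; first exact: convergent_yfac.
    apply: peelable_unit => //; first exact: convergent_yfac.
    by rewrite /= coefsD /sconst /sY /= addr0.
  rewrite tN /= sconst0 add0r in npy strict_eq *.
  have -> : I = ideal (@sY R).
    apply: contrapT => nY; apply: npy.
    by apply: peelableX; [exact: convergent_sY | exact: peelable_sY].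
  split; [exact: smooth_sY | |].
    by rewrite exprS mulrCA -!mulrA; apply: ideal_mem; cv.
  apply/strict_transformP; first exact: smooth_sY.
  split; first by apply/tangentE; rewrite mulr0 add0r.
  by rewrite (strict_eq _ (@sY R)) // pull1_sY /= sconst0 add0r.
move=> hI; have {hI} := py _ (convergent_pull1 _ ch) hI.
case: hh => [->|sh].
  by rewrite pull11 => /(branch_proper bI (convergent1 R)); rewrite coefs1 oner_eq0 => /(_ isT).
have [_ h0 _] := sh; rewrite strictE // => /(pX _ (convergent_strict t ch)) hI.
have [th|nth] := pselect (tangent t h); last first.
  by have := branch_proper bI (convergent_strict t ch) (strict_unit nth) hI.
exists h; split=> //; first by apply: ideal_mull; [cv | apply: ideal_self].
by apply/strict_transformP => //; split=> //; apply: branch_smooth => //; apply: smooth_strict.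
Qed.

End Branches.

(** * Infinitely near points and crosses *)

Section Words.
Variable R : realType.
Implicit Types (P Q : ipoint R) (t : direction R).

Lemma ile_refl P : ile P P. Proof. exact: prefix_refl. Qed.

Lemma ile_trans P Q Q' : ile P Q -> ile Q Q' -> ile P Q'.
Proof. exact: prefix_trans. Qed.

Lemma ile_rcons P Q t : ile P (rcons Q t) <-> P = rcons Q t \/ ile P Q.
Proof.
rewrite /ile; split=> [/prefixP[s]|[->|h]]; last first.
- exact: prefix_trans h (prefix_rcons _ _).
- exact: prefix_refl.
case: (lastP s) => [|s' u]; first by rewrite cats0; left.
by rewrite -rcons_cat => /rcons_inj[-> _]; right; apply: prefix_prefix.
Qed.

Lemma ile_size P Q : ile P Q -> (size P <= size Q)%N.
Proof. exact: size_prefix. Qed.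

Lemma ile_anti P Q : ile P Q -> (size Q <= size P)%N -> P = Q.
Proof.
move=> /prefixP[s ->]; rewrite size_cat -{2}[size P]addn0 leq_add2l leqn0.
by rewrite size_eq0 => /eqP ->; rewrite cats0.
Qed.

Lemma ilt_rcons P Q t : ilt P (rcons Q t) <-> ile P Q.
Proof.
split=> [[/ile_rcons[]//]|h]; split; first by apply/ile_rcons; right.
by move=> e; have := ile_size h; rewrite e size_rcons ltnn.
Qed.

Lemma ilt_size P Q : ilt P Q -> (size P < size Q)%N.
Proof.
move=> [h ne]; rewrite ltnNge; apply/negP => hs; apply: ne.
exact: ile_anti.
Qed.

Lemma ile_ltP P Q : ile P Q -> P = Q \/ exists t, ile (rcons P t) Q.
Proof.
move=> /prefixP[[|t s] ->]; first by left; rewrite cats0.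
by right; exists t; rewrite -cat_rcons; apply: prefix_prefix.
Qed.

Lemma ilt_trans_le P Q Q' : ilt P Q -> ile Q Q' -> ilt P Q'.
Proof.
move=> h h'; split; first exact: ile_trans h.1 h'.
by move=> e; have := ilt_size h; have := ile_size h'; rewrite -e; case: ltngtP.
Qed.

Lemma ile_rcons_inj P Q t t' : ile (rcons P t) Q -> ile (rcons P t') Q -> t = t'.
Proof.
move=> /prefixP[s ->] /prefixP[s']; rewrite !cat_rcons => /eqP.
by rewrite eqseq_cat // => /andP[_ /eqP[]].
Qed.

(** In the third case, [Q0] is the longest common prefix. This trichotomy organizes every comparison
    of two points through which the same curve passes. *)
Lemma ile_total_or_fork P Q : [\/ ile P Q, ile Q P |
  exists Q0 t t', [/\ t <> t', ile (rcons Q0 t) P & ile (rcons Q0 t') Q]].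
Proof.
elim: P Q => [|x P IH] [|y Q]; [exact: Or31|exact: Or31|exact: Or32|].
have [->|xy] := eqVneq x y; last first.
  apply: Or33; exists [::], x, y; split; first exact/eqP.
    by rewrite /ile /= eqxx ?prefix0s.
  by rewrite /ile /= eqxx ?prefix0s.
case: (IH Q) => [h|h|[Q0 [t [t' [tt h h']]]]].
- by apply: Or31; rewrite /ile /= eqxx.
- by apply: Or32; rewrite /ile /= eqxx.
- by apply: Or33; exists (y :: Q0), t, t'; split; rewrite // /ile /= eqxx.
Qed.

End Words.

(** * Branches of a cross and their tangent directions *)

Section Crosses.
Variable R : realType.
Notation S := (series R).
Implicit Types (X : set (set S)) (f g : S) (I J K : set S) (t : direction R).

(** [preimage_germ] admits any convergent generator of a branch, so smoothness must not depend on
    the generator. *)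
Lemma smooth_ideal_eq f g : smooth f -> convergent g -> ideal g = ideal f -> smooth g.
Proof.
move=> [cf f0 f1] cg e; have := ideal_self g; rewrite e => -[w cw e1].
have := ideal_self f; rewrite -e => -[v cv' e2].
have g0 : g 0%N 0%N = 0 by rewrite e1 smulE coefsM00 f0 mul0r.
split=> //; case: f1 => h; [left | right]; move: h;
  by rewrite e2 smulE ?coefsM10 ?coefsM01 g0 mul0r add0r mulf_eq0 negb_or => /andP[].
Qed.

Lemma crossP X : is_cross X <-> exists f g, [/\ smooth f, smooth g,
  f 1%N 0%N * g 0%N 1%N - f 0%N 1%N * g 1%N 0%N != 0 & X = [set ideal f; ideal g]].
Proof.
split=> -[f [g []]] => [[cf cg] [f0 g0] d ->|[cf f0 _] [cg g0 _] d ->]; exists f, g; split=> //.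
- split=> //; have [f1|] := eqVneq (f 1%N 0%N) 0; last by left.
  by right; apply: contraNneq d => f2; rewrite f1 f2 !mul0r subr0.
- split=> //; have [g1|] := eqVneq (g 1%N 0%N) 0; last by left.
  by right; apply: contraNneq d => g2; rewrite g1 g2 !mulr0 subr0.
Qed.

Lemma det_ideal_neq f g : f 0%N 0%N = 0 ->
  f 1%N 0%N * g 0%N 1%N - f 0%N 1%N * g 1%N 0%N != 0 -> ideal f <> ideal g.
Proof.
move=> f0 d e; have := ideal_self g; rewrite -e => -[w cw]; rewrite smulE => e1.
move/eqP: d; apply; rewrite e1 coefsM10 coefsM01 f0 !mul0r !add0r; ring.
Qed.

Lemma cross_smooth X I : is_cross X -> X I -> exists2 f, smooth f & I = ideal f.
Proof. by move=> /crossP[f [g [sf sg _ ->]]] [->|->]; [exists f|exists g]. Qed.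

(** Linearly independent differentials have distinct kernels, so at most one branch of a cross
    passes through a given point of the exceptional curve. *)
Lemma cross_tangent_uniq X t I J I' J' : is_cross X -> X I -> X J ->
  strict_transform t I I' -> strict_transform t J J' -> I = J.
Proof.
move=> /crossP[f [g [sf sg d ->]]].
have nt : ~ (tangent t f /\ tangent t g).
  by move=> [tf tg]; move/eqP: d; apply; apply: (tangent_det tf tg).
by move=> [->|->] [->|->] // /strict_transformP-/(_ ltac:(done))[h1 _]
  /strict_transformP-/(_ ltac:(done))[h2 _]; case: nt.
Qed.

Lemma strict_transform_uniq X t I J J' : is_cross X -> X I ->
  strict_transform t I J -> strict_transform t I J' -> J = J'.
Proof.
move=> cX /(cross_smooth cX)[f sf ->] /(strict_transformP _ _ sf)[_ ->].
by move=> /(strict_transformP _ _ sf)[_ ->].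
Qed.

Lemma cross_direction_uniq X t t' I J J' : is_cross X -> X I ->
  strict_transform t I J -> strict_transform t' I J' -> t = t'.
Proof.
move=> cX /(cross_smooth cX)[f sf ->] /(strict_transformP _ _ sf)[h _].
by move=> /(strict_transformP _ _ sf)[h' _]; apply: tangent_uniq h h'.
Qed.

Lemma cross_direction X I : is_cross X -> X I -> exists t J, strict_transform t I J.
Proof.
move=> cX /(cross_smooth cX)[f sf ->]; have [t tf] := smooth_tangent sf.
by exists t, (ideal (strict t f)); apply/strict_transformP.
Qed.

Lemma cross_pair X : is_cross X -> exists I J, I <> J /\ X = [set I; J].
Proof.
move=> /crossP[f [g [sf sg d ->]]]; exists (ideal f), (ideal g); split=> //.
by apply: det_ideal_neq d; case: sf.
Qed.

Lemma cross_sub_eq X Y : is_cross X -> is_cross Y -> X `<=` Y -> X = Y.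
Proof.
move=> /cross_pair[I [J [IJ ->]]] /cross_pair[I' [J' [_ ->]]] h.
apply/seteqP; split=> // Z; have := h I (or_introl erefl); have := h J (or_intror erefl).
by move=> [] e1 [] e2 [] ->;
  first [left; congruence | right; congruence | case: IJ; congruence].
Qed.

Lemma decomposable_pull s f : smooth f -> decomposable (pull s f).
Proof.
move=> sf; elim/last_ind: s => [|s t IH]; first exact: decomposable_smooth.
by rewrite /pull foldl_rcons; apply: decomposable_pull1.
Qed.

End Crosses.

(** * Total transforms and the germs of the lotus vertices *)

Section Constellation.
Variables (R : realType) (C : constellation R).
Notation S := (series R).
Implicit Types (P Q : ipoint R) (f g : S) (I J K : set S) (t : direction R) (v w : curve R).
Local Notation total := (total_transform C).
Local Notation current := (current_transform C).

(** The points that appear while the active points are being blown up; the model points are those of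
    them that are not active. Inductions on germs range over these points. *)
Definition stage Q : Prop := forall P, ilt P Q -> active C P.

Lemma stage_points Q : points C Q -> stage Q.
Proof. by move=> pQ P; apply: active_nonmaximal. Qed.

Lemma stage_rconsP P t : stage (rcons P t) <-> active C P.
Proof.
split=> [|aP P' /ilt_rcons]; first by apply; apply/ilt_rcons/ile_refl.
move=> h; have [->//|ne] := pselect (P' = P).
exact: (active_nonmaximal (active_points aP)).
Qed.

Lemma stage_active P : active C P -> stage P.
Proof. by move=> /active_points; apply: stage_points. Qed.

Lemma stage_down P Q : stage Q -> ile P Q -> stage P.
Proof. by move=> sQ h P' h'; apply: sQ; apply: ilt_trans_le h. Qed.

Lemma pcross P : points C P -> is_cross (cross C P).
Proof. exact: cross_is_cross. Qed.

Lemma total_points Q : points C Q -> total Q = cross C Q.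
Proof.
move=> pQ; apply/seteqP; split=> I.
  by move=> [P [pP PQ]]; apply: cross_compatible.
move=> XI; exists Q; split=> //; first exact: ile_refl.
have [f sf e] := cross_smooth (pcross pQ) XI.
split; first by rewrite e; apply: smooth_branch.
by exists [::], f; rewrite cats0 -e /= e; split=> //; [case: sf | rewrite -e | apply: ideal_self].
Qed.

Lemma current_total Q : current Q `<=` total Q.
Proof. by move=> I [P [pP [PQ _] h]]; exists P. Qed.

Lemma total_not_points Q : ~ points C Q -> total Q = current Q.
Proof.
move=> nQ; apply/seteqP; split; last exact: current_total.
by move=> I [P [pP PQ h]]; exists P; split=> //; split=> // e; rewrite -e in nQ.
Qed.

Lemma current_cross_sub Q : points C Q -> current Q `<=` cross C Q.
Proof. by move=> pQ; rewrite -total_points //; apply: current_total. Qed.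

(** The contributions of the points below P already lie in X_P by compatibility, so one blowup
    decides: the germ consists of E_P and of the strict transforms of the branches of X_P. *)
Lemma current_rcons P t I : active C P ->
  current (rcons P t) I <->
  I = ideal (sX R) \/ exists2 K, cross C P K & strict_transform t K I.
Proof.
move=> aP; have pP := active_points aP; split.
  move=> [P' [pP' /ilt_rcons h [bI [s [f [e cf Xf If]]]]]].
  have [f' sf' e'] := cross_smooth (pcross pP') Xf.
  have sf := smooth_ideal_eq sf' cf e'.
  case/lastP: s e If => [|s u].
    by move=> e; have := ile_size h; rewrite -(cats0 P') -e size_rcons ltnn.
  rewrite -rcons_cat => /rcons_inj[eP <-]; rewrite /pull foldl_rcons.
  (* A branch other than E_P is the strict transform of a branch at P on which the pull-back of [f]
     vanishes, hence of a branch of X_P. *)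
  move=> /(branch_pull1 (decomposable_pull s sf) bI)[->|[g [sg gf hI]]]; first by left.
  right; exists (ideal g) => //; apply: (cross_compatible pP' pP h).
  by split; [apply: smooth_branch | exists s, f].
move=> h; exists P; split=> //; first exact/ilt_rcons/ile_refl.
case: h => [->|[K XK tK]].
  have [K [K' [_ eX]]] := cross_pair (pcross pP).
  have XK : cross C P K by rewrite eX; left.
  have [f sf e] := cross_smooth (pcross pP) XK.
  split; first by apply: smooth_branch; apply: smooth_sX.
  exists [:: t], f; rewrite -e cats1; split=> //; first by case: sf.
  rewrite /= strictE; last by case: sf.
  by apply: ideal_mem; apply: convergent_strict; case: sf.
have [f sf e] := cross_smooth (pcross pP) XK.
split; first by case: tK.
exists [:: t], f; rewrite -e cats1; split=> //; first by case: sf.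
by case: tK => _ _; apply; rewrite e; apply: ideal_self.
Qed.

Lemma current_origin I : ~ current [::] I.
Proof. by move=> [P [_ h _]]; have := ilt_size h. Qed.

Lemma current_is_cross P t K J : active C P -> cross C P K ->
  strict_transform t K J -> is_cross (current (rcons P t)).
Proof.
move=> aP XK tK; have cP := pcross (active_points aP).
have [f sf e] := cross_smooth cP XK; rewrite e in XK tK.
have [tf eJ] := (strict_transformP t J sf).1 tK.
apply/crossP; exists (sX R), (strict t f); split.
- exact: smooth_sX.
- exact: smooth_strict.
- rewrite /sX /= mul1r mul0r subr0; exact: strict_01.
apply/seteqP; split=> I /=.
  move=> /(current_rcons _ _ aP)[->|[K' XK' tK']]; first by left.
  have eK := cross_tangent_uniq cP XK XK' tK tK'; rewrite -eK in tK'.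
  by right; rewrite -eJ; exact: (strict_transform_uniq cP XK tK' tK).
move=> h; apply/current_rcons => //; case: h => ->; first by left.
by right; exists (ideal f) => //; rewrite -eJ.
Qed.

Lemma current_rconsX P t : active C P -> current (rcons P t) (ideal (sX R)).
Proof. by move=> aP; apply/current_rcons => //; left. Qed.

Lemma total_cases Q : stage Q -> is_cross (total Q) \/
  exists P t, [/\ active C P, Q = rcons P t, ~ points C Q & total Q = [set ideal (sX R)]].
Proof.
move=> sQ; have [pQ|nQ] := pselect (points C Q).
  by left; rewrite total_points //; apply: pcross.
case/lastP: Q nQ sQ => [|P t] nQ sQ; first by case: nQ; apply: points_origin.
have aP := (stage_rconsP P t).1 sQ.
have [[K XK [J tK]]|h] := pselect (exists2 K, cross C P K & exists J, strict_transform t K J).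
  by left; rewrite total_not_points //; apply: current_is_cross tK.
right; exists P, t; split=> //; rewrite total_not_points //.
apply/seteqP; split=> I; last by move=> ->; apply: current_rconsX.
move=> /(current_rcons _ _ aP)[//|[K XK tK]]; case: h; exists K => //; by exists I.
Qed.

Lemma singular_pointP Q : singular_point C Q <-> model_point C Q /\ is_cross (total Q).
Proof.
split=> [[mQ _ h]|[mQ cQ]].
  split=> //; case: (total_cases (mQ.2)) => // -[P [t [_ _ _ e]]].
  case: h; exists (ideal (sX R)) => //; exists (sX R).
  by have [*] := smooth_sX R; split.
have [I [J [IJ e]]] := cross_pair cQ; split=> //; first by exists I; rewrite e; left.
move=> [K _]; rewrite e => e'; apply: IJ.
have : [set K] I by rewrite -e'; left.
have : [set K] J by rewrite -e'; right.
by move=> -> ->.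
Qed.

Lemma not_base_point Q : points C Q -> ~ base_point C Q -> current Q = cross C Q.
Proof.
move=> pQ nb; have cQ : is_cross (current Q) by apply: contrapT => h; apply: nb.
by apply: cross_sub_eq => //; [apply: pcross | apply: current_cross_sub].
Qed.

Lemma germ_inv v Q I : germ_of v Q I ->
  [\/ exists P t, [/\ v = Exc P, Q = rcons P t & I = ideal (sX R)],
      v = Bra Q I |
      exists P t K, [/\ Q = rcons P t, germ_of v P K & strict_transform t K I]].
Proof.
case=> [P t|P J|{}v P t K J h h'].
- by apply: Or31; exists P, t.
- exact: Or32.
- by apply: Or33; exists P, t, K.
Qed.

Lemma germ_bound v Q I : germ_of v Q I ->
  match v with Exc P => ilt P Q | Bra P _ => ile P Q end.
Proof.
elim=> [P t|P J|{}v P t K J _ IH _].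
- exact/ilt_rcons/ile_refl.
- exact: ile_refl.
- case: v IH => [P'|P' K'] h; first by apply/ilt_rcons; case: h.
  by apply/ile_rcons; right.
Qed.

Definition lotus_vertex v : Prop := base_vertex C v \/ lateral_vertex C v.

Lemma lotus_vertexE P : lotus_vertex (Exc P) <-> active C P.
Proof.
split; last by move=> aP; right; exists P.
by case=> [[Q [I [_ _ _]]]//|[P' aP' [<-]]].
Qed.

Lemma lotus_vertexB P I : lotus_vertex (Bra P I) <->
  [/\ base_point C P, cross C P I & ~ current P I].
Proof.
split=> [|h]; last by left; exists P, I; case: h.
by case=> [[Q [J [? ? ? [-> ->]]]]|[P' _]].
Qed.

Lemma germ_total v Q I : lotus_vertex v -> stage Q -> germ_of v Q I -> total Q I.
Proof.
move=> lv; elim/last_ind: Q I => [|Q t IH] I sQ /germ_inv[].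
- by move=> [P [t [_ /(congr1 size)]]]; rewrite size_rcons.
- move=> e; move: lv; rewrite e => /lotus_vertexB[_ h _].
  by rewrite total_points //; apply: points_origin.
- by move=> [P [t [K [/(congr1 size)]]]]; rewrite size_rcons.
- move=> [P [t' [_ _ ->]]].
  by apply: current_total; apply: current_rconsX; exact: ((stage_rconsP Q t).1 sQ).
- move=> e; move: lv; rewrite e => /lotus_vertexB[[pQ _] h _].
  by rewrite total_points.
move=> [P [t' [K [/rcons_inj[<- <-] gK tK]]]].
have aQ := (stage_rconsP Q t).1 sQ.
apply: current_total; apply/current_rcons => //; right; exists K => //.
rewrite -total_points; last exact: active_points.
exact: IH (stage_active aQ) gK.
Qed.

Lemma germ_cross v P I : lotus_vertex v -> active C P -> germ_of v P I -> cross C P I.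
Proof.
move=> lv aP gI; rewrite -total_points; last exact: active_points.
exact: germ_total (stage_active aP) gI.
Qed.

Lemma germ_current v P t I : lotus_vertex v -> active C P ->
  germ_of v (rcons P t) I -> v = Bra (rcons P t) I \/ current (rcons P t) I.
Proof.
move=> lv aP /germ_inv[[P' [t' [_ _ ->]]]|->|]; [by right; apply: current_rconsX|by left|].
move=> [P' [t' [K [/rcons_inj[<- <-] gK tK]]]].
by right; apply/current_rcons => //; right; exists K => //; apply: germ_cross gK.
Qed.

(** At an active point the germ of [v] is a branch of the cross, which is smooth and so has only one
    strict transform in a given direction. *)
Lemma germ_fun v Q I J : lotus_vertex v -> stage Q ->
  germ_of v Q I -> germ_of v Q J -> I = J.
Proof.
move=> lv; elim/last_ind: Q I J => [|Q t IH] I J sQ.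
  move=> /germ_inv[[P [t [_ /(congr1 size)]]]|e|[P [t [K [/(congr1 size)]]]]];
    rewrite ?size_rcons // e.
  move=> /germ_inv[[P [t [_ /(congr1 size)]]]|[]|[P [t [K [/(congr1 size)]]]]] //;
    by rewrite size_rcons.
have aQ := (stage_rconsP Q t).1 sQ.
(* The mixed cases fail on the constructor of [v], or because [v] would be created at or above a
   point strictly above one through which it already passes. *)
move=> gI gJ; case: (germ_inv gI); case: (germ_inv gJ).
- by move=> [P [t' [_ _ ->]]] [P' [t'' [_ _ ->]]].
- by move=> -> [P' [t'' []]].
- move=> [P [t' [K [/rcons_inj[<- <-] gK tK]]]] [P' [t'' [e /rcons_inj[eQ _] _]]].
  by have := germ_bound gK; rewrite e eQ => /ilt_size; rewrite ltnn.
- by move=> [P' [t'' [-> _ _]]].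
- by move=> -> [->].
- move=> [P [t' [K [/rcons_inj[<- <-] gK tK]]]] e.
  by have := germ_bound gK; rewrite e => /ile_size; rewrite size_rcons ltnn.
- move=> [P' [t'' [e /rcons_inj[eQ _] _]]] [P [t' [K [/rcons_inj[<- <-] gK tK]]]].
  by have := germ_bound gK; rewrite e eQ => /ilt_size; rewrite ltnn.
- move=> e [P [t' [K [/rcons_inj[<- <-] gK tK]]]].
  by have := germ_bound gK; rewrite e => /ile_size; rewrite size_rcons ltnn.
move=> [P [t' [K [/rcons_inj[<- <-] gK tK]]]] [P' [t'' [K' [/rcons_inj[<- <-] gK' tK']]]].
have e := IH _ _ (stage_active aQ) gK gK'; rewrite -e in tK'.
exact: strict_transform_uniq (pcross (active_points aQ)) (germ_cross lv aQ gK) tK' tK.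
Qed.

(** Going down from Q, a common germ which is a strict transform comes from a common branch of the
    cross below; a common exceptional germ determines its curve; a curvetta shares its germ with no
    older curve. *)
Lemma germ_inj v w Q I : lotus_vertex v -> lotus_vertex w -> stage Q ->
  germ_of v Q I -> germ_of w Q I -> v = w.
Proof.
move=> lv lw; elim/last_ind: Q I => [|Q t IH] I sQ.
  move=> /germ_inv[[P [t [_ /(congr1 size)]]]|->|[P [t [K [/(congr1 size)]]]]];
    rewrite ?size_rcons //.
  move=> /germ_inv[[P [t [_ /(congr1 size)]]]|->|[P [t [K [/(congr1 size)]]]]] //;
    by rewrite size_rcons.
have aQ := (stage_rconsP Q t).1 sQ.
(* A curvetta is by definition outside the current transform, which contains the germs of all the
   vertices created earlier. *)
have bra u u' : lotus_vertex u -> lotus_vertex u' -> u = Bra (rcons Q t) I ->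
    germ_of u' (rcons Q t) I -> u' = u.
  move=> lu lu' eu /(germ_current lu' aQ)[->//|cI].
  by move: lu; rewrite eu => /lotus_vertexB[_ _ []].
move=> gv gw; case: (germ_inv gv) => [[P [t' [ev /rcons_inj[eQ _] eI]]]|ev|]; last 1 first.
- move=> [P [t' [K [/rcons_inj[<- <-] gK tK]]]].
  case: (germ_inv gw) => [[P' [t'' [_ _ eI]]]|ew|].
  + by case: tK => _; rewrite eI.
  + exact: bra ew gv.
  move=> [P' [t'' [K' [/rcons_inj[<- <-] gK' tK']]]].
  have e := cross_tangent_uniq (pcross (active_points aQ)) (germ_cross lv aQ gK)
     (germ_cross lw aQ gK') tK tK'.
  by apply: IH (stage_active aQ) gK _; rewrite e.
- case: (germ_inv gw) => [[P' [t'' [ew /rcons_inj[eQ' _] _]]]|ew|].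
  + by rewrite ev ew -eQ -eQ'.
  + exact: bra ew gv.
  by move=> [P' [t'' [K' [_ _ [_]]]]]; rewrite eI.
- by symmetry; apply: bra ev gw.
Qed.

(** A branch at Q is E of the preceding point, the strict transform of an older branch, or absent
    from the current transform; in the last case Q is a base point and the branch is a base
    vertex. *)
Lemma germ_exists Q I : stage Q -> total Q I ->
  exists2 v, lotus_vertex v & germ_of v Q I.
Proof.
elim/last_ind: Q I => [|Q t IH] I sQ TI.
  have p0 := points_origin C.
  exists (Bra [::] I); last exact: germ_bra.
  apply/lotus_vertexB; split; last exact: current_origin; last by rewrite -total_points.
  split=> // /cross_pair[K [J [_ e]]]; apply: (@current_origin K).
  by rewrite e; left.
have aQ := (stage_rconsP Q t).1 sQ.
have [/(current_rcons _ _ aQ)[->|[K XK tK]]|ncI] := pselect (current (rcons Q t) I).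
- by exists (Exc Q); [apply/lotus_vertexE | apply: germ_exc].
- have TK : total Q K by rewrite total_points //; apply: active_points.
  have [v lv gv] := IH K (stage_active aQ) TK.
  by exists v => //; apply: germ_strict tK.
have pQ : points C (rcons Q t).
  by apply: contrapT => nQ; apply: ncI; rewrite -total_not_points.
rewrite total_points // in TI.
exists (Bra (rcons Q t) I); last exact: germ_bra.
apply/lotus_vertexB; split=> //; apply: contrapT => nb; apply: ncI.
by rewrite not_base_point.
Qed.

End Constellation.

(** * The lateral boundary and the dual graph *)

Section Isomorphism.
Variables (R : realType) (C : constellation R).
Notation S := (series R).
Implicit Types (P Q : ipoint R) (f g : S) (I J K : set S) (t : direction R) (v w : curve R).
Local Notation total := (total_transform C).
Local Notation current := (current_transform C).
Local Notation lotus_vertex := (lotus_vertex C).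
Local Notation stage := (stage C).

Definition passes v Q : Prop := exists I, germ_of v Q I.

(** Followed downwards from Q, a curve persists until the point [Q0] where it is created. *)
Lemma passes_or_origin v Q Q' : passes v Q -> ile Q' Q -> passes v Q' \/
  exists Q0, [/\ ile Q' Q0, ile Q0 Q & v = Exc Q0 \/ exists I, v = Bra Q0 I].
Proof.
elim/last_ind: Q => [|Q t IH] pv h.
  have e : Q' = [::] by apply: ile_anti.
  by left; rewrite e.
have [->|h'] := (ile_rcons _ _ _).1 h; first by left.
case: pv => I /germ_inv[[P [u [-> /rcons_inj[eQ _] _]]]|->|].
- by right; exists P; rewrite -eQ; split=> //; [apply/ile_rcons; right; apply: ile_refl | left].
- by right; exists (rcons Q t); split=> //; [apply: ile_refl | right; exists I].
move=> [P [u [K [/rcons_inj[<- _] gK _]]]].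
have [|[Q0 [h1 h2 h3]]] := IH (ex_intro _ K gK) h'; first by left.
by right; exists Q0; split=> //; apply/ile_rcons; right.
Qed.

Lemma passes_between v Q Q' Q'' : passes v Q -> passes v Q'' ->
  ile Q Q' -> ile Q' Q'' -> passes v Q'.
Proof.
move=> pQ pQ'' h h'; have [//|[Q0 [h1 h2 h3]]] := passes_or_origin pQ'' h'.
case: (pQ) => I /germ_bound h4; case: h3 => [e|[J e]]; rewrite e in h4.
  by have := ilt_size h4; have := ile_size (ile_trans h h1); case: ltngtP.
by rewrite -(ile_anti h (leq_trans (ile_size h1) (ile_size h4))).
Qed.

Lemma germ_strict_inv v P t I : lotus_vertex v -> passes v P ->
  germ_of v (rcons P t) I -> exists2 K, germ_of v P K & strict_transform t K I.
Proof.
move=> lv [J gJ] /germ_inv[[P' [t' [e /rcons_inj[eP _] _]]]|e|].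
- by have := germ_bound gJ; rewrite e -eP => /ilt_size; rewrite ltnn.
- by have := germ_bound gJ; rewrite e => /ile_size; rewrite size_rcons ltnn.
by move=> [P' [t' [K [/rcons_inj[<- <-] gK tK]]]]; exists K.
Qed.

(** A curve other than E_P through two points of E_P, or through points above them, would have two
    tangents at P. *)
Lemma passes_fork v P Q Q' t t' : lotus_vertex v -> stage Q -> stage Q' ->
  passes v Q -> passes v Q' -> ile (rcons P t) Q -> ile (rcons P t') Q' ->
  t <> t' -> v = Exc P.
Proof.
move=> lv sQ sQ' pQ pQ' h h' tt'.
(* The curve is not created on one of the two arms of the fork, since the other arm does not lie
   above such a point. *)
have pass u u' Q1 Q2 : passes v Q1 -> passes v Q2 -> ile (rcons P u) Q1 ->
    ile (rcons P u') Q2 -> u <> u' -> passes v (rcons P u).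
  move=> p1 [I /germ_bound p2] h1 h2 ne.
  have [//|[Q0 [k1 k2 k3]]] := passes_or_origin p1 h1.
  case: ne; apply: ile_rcons_inj _ h2; apply: ile_trans k1 _.
  by case: k3 p2 => [->|[J ->]] // [].
have [I gI] := pass _ _ _ _ pQ pQ' h h' tt'.
have [I' gI'] := pass _ _ _ _ pQ' pQ h' h (not_eq_sym tt').
have aP := (stage_rconsP C P t).1 (stage_down sQ h).
apply: contrapT => nv.
have down u J : u = t \/ u = t' -> germ_of v (rcons P u) J ->
    exists2 K, germ_of v P K & strict_transform u K J.
  move=> hu /germ_inv[[P' [u' [e /rcons_inj[eP _] _]]]|e|].
  - by case: nv; rewrite e eP.
  - have b1 := germ_bound gI; have b2 := germ_bound gI'.
    rewrite e in b1 b2.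
    have e1 := ile_anti b1 (_ : size (rcons P t) <= size (rcons P u))%N.
    have e2 := ile_anti b2 (_ : size (rcons P t') <= size (rcons P u))%N.
    rewrite !size_rcons in e1 e2; case: tt'.
    by move: (e2 (ltnSn _)); rewrite (e1 (ltnSn _)) => /rcons_inj[].
  by move=> [P' [u' [K [/rcons_inj[<- <-] gK tK]]]]; exists K.
have [K gK tK] := down t I (or_introl erefl) gI.
have [K' gK' tK'] := down t' I' (or_intror erefl) gI'.
rewrite (germ_fun lv (stage_active aP) gK' gK) in tK'.
by apply: tt'; apply: cross_direction_uniq (pcross (active_points aP)) (germ_cross lv aP gK) tK tK'.
Qed.

(** With the total transform in place of the cross, the segment also makes sense at model points
    outside the constellation; at points of the constellation the two agree. *)
Definition segment Q : set (curve R) := dual_segment C Q (total Q).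

Lemma segmentP Q v : stage Q -> segment Q v <-> lotus_vertex v /\ passes v Q.
Proof.
move=> sQ; split=> [[lv [I _ gI]]|[lv [I gI]]]; first by split=> //; exists I.
by split=> //; exists I => //; apply: germ_total gI.
Qed.

Lemma segment_pair Q : stage Q -> is_cross (total Q) ->
  exists v w, [/\ v <> w, segment Q v, segment Q w &
    forall u, segment Q u -> u = v \/ u = w].
Proof.
move=> sQ /cross_pair[I [J [IJ e]]].
have TI : total Q I by rewrite e; left.
have TJ : total Q J by rewrite e; right.
have [v lv gv] := germ_exists sQ TI; have [w lw gw] := germ_exists sQ TJ.
exists v, w; split.
- by move=> vw; apply: IJ; rewrite vw in gv; exact: (germ_fun lw sQ gv gw).
- by apply/segmentP => //; split=> //; exists I.
- by apply/segmentP => //; split=> //; exists J.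
move=> u /(segmentP _ sQ)[lu [K gK]].
have := germ_total lu sQ gK; rewrite e => -[] eK; rewrite eK in gK; [left|right].
  exact: germ_inj lu lv sQ gK gv.
exact: germ_inj lu lw sQ gK gw.
Qed.

Lemma common_passes v w Q Q' : v <> w -> lotus_vertex v -> lotus_vertex w ->
  stage Q' -> passes v Q -> passes v Q' -> passes w Q -> passes w Q' ->
  ile Q Q' -> Q = Q'.
Proof.
move=> vw lv lw sQ' vQ vQ' wQ wQ' h.
have [//|[t ht]] := ile_ltP h; exfalso.
have aQ := (stage_rconsP C Q t).1 (stage_down sQ' ht).
have hQ : ile Q (rcons Q t) by apply/ile_rcons; right; apply: ile_refl.
have [I gI] := passes_between vQ vQ' hQ ht.
have [J gJ] := passes_between wQ wQ' hQ ht.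
have [K gK tK] := germ_strict_inv lv vQ gI.
have [K' gK' tK'] := germ_strict_inv lw wQ gJ.
have e := cross_tangent_uniq (pcross (active_points aQ)) (germ_cross lv aQ gK)
  (germ_cross lw aQ gK') tK tK'.
by rewrite -e in gK'; apply: vw; apply: (germ_inj lv lw (stage_active aQ) gK gK').
Qed.

(** Segments are sets of vertices, so a point must be recovered from its segment. If Q and Q' fork
    at P, both ends of the segment would be E_P. *)
Lemma segment_inj Q Q' : stage Q -> stage Q' -> is_cross (total Q) ->
  segment Q = segment Q' -> Q = Q'.
Proof.
move=> sQ sQ' cQ e; have [v [w [vw sv sw _]]] := segment_pair sQ cQ.
have [lv vQ] := (segmentP _ sQ).1 sv; have [lw wQ] := (segmentP _ sQ).1 sw.
rewrite e in sv sw.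
have [_ vQ'] := (segmentP _ sQ').1 sv; have [_ wQ'] := (segmentP _ sQ').1 sw.
have [h|h|[P [t [t' [tt' h h']]]]] := ile_total_or_fork Q Q'.
- exact: (common_passes vw).
- by symmetry; exact: (common_passes vw).
case: vw; rewrite (passes_fork lv sQ sQ' vQ vQ' h h' tt').
by rewrite (passes_fork lw sQ sQ' wQ wQ' h h' tt').
Qed.

Lemma active_bound : exists N, forall P, active C P -> (size P < N)%N.
Proof.
have fA : finite_set (active C) by apply: sub_finite_set (points_finite C); apply: active_points.
have [s es] := (finite_seqP _).1 fA.
exists (\max_(P <- s) size P).+1 => P aP; rewrite ltnS.
by apply: leq_bigmax_seq => //; move: aP; rewrite es.
Qed.

(** Each step blows up an active point, and the lengths of active words are bounded. The total
    transform remains a cross: above an active point it contains E and the strict transform of the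
    branch followed. *)
Lemma reach_singular v Q K : lotus_vertex v -> stage Q -> is_cross (total Q) ->
  germ_of v Q K -> exists Q' I, [/\ singular_point C Q', ile Q Q' & germ_of v Q' I].
Proof.
move=> lv; have [N hN] := active_bound.
have [n] := ubnP (N - size Q); elim: n Q K => // n IH Q K hn sQ cQ gK.
have [aQ|nQ] := pselect (active C Q); last first.
  by exists Q, K; split=> //; [apply/singular_pointP | apply: ile_refl].
have XK := germ_cross lv aQ gK; have cX := pcross (active_points aQ).
have [t [J tK]] := cross_direction cX XK.
have cQ' : is_cross (total (rcons Q t)).
  have [pQ|npQ] := pselect (points C (rcons Q t)).
    by rewrite total_points //; apply: pcross.
  by rewrite total_not_points //; apply: current_is_cross tK.
have hs : (N - size (rcons Q t) < n)%N.
  by have := hN _ aQ; move: hn; rewrite size_rcons; clear; lia.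
have [Q' [I [sQ' h gI]]] := IH _ _ hs ((stage_rconsP C Q t).2 aQ) cQ' (germ_strict gK tK).
by exists Q', I; split=> //; apply: ile_trans h; apply/ile_rcons; right; apply: ile_refl.
Qed.

(** For E_P one starts from the point where it meets the strict transform of a branch of X_P; for a
    base vertex, from the point where it is created. *)
Lemma lotus_vertex_singular v : lotus_vertex v ->
  exists Q I, singular_point C Q /\ germ_of v Q I.
Proof.
case: v => [P /lotus_vertexE aP|P I lv].
  have cX := pcross (active_points aP).
  have [K [K' [_ eX]]] := cross_pair cX.
  have XK : cross C P K by rewrite eX; left.
  have [t [J tK]] := cross_direction cX XK.
  have cQ : is_cross (total (rcons P t)).
    have [pQ|npQ] := pselect (points C (rcons P t)).
      by rewrite total_points //; apply: pcross.
    by rewrite total_not_points //; apply: current_is_cross tK.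
  have [Q [I [sQ _ gI]]] := reach_singular ((lotus_vertexE C P).2 aP)
     ((stage_rconsP C P t).2 aP) cQ (germ_exc P t).
  by exists Q, I.
have [[pP _] _ _] := (lotus_vertexB C P I).1 lv.
have cP : is_cross (total P) by rewrite total_points //; apply: pcross.
have [Q [J [sQ _ gJ]]] := reach_singular lv (stage_points pP) cP (germ_bra P I).
by exists Q, J.
Qed.

Lemma singular_stage Q : singular_point C Q -> stage Q.
Proof. by case=> -[]. Qed.

Lemma lateral_boundary_edges :
  edges (lateral_boundary C) = [set segment Q | Q in singular_point C].
Proof.
have segm Q : points C Q -> dual_segment C Q (cross C Q) = segment Q.
  by move=> pQ; rewrite /segment total_points.
apply/seteqP; split=> s /=.
  case=> [[_ _ [Q sQ ->]]|[Q [[pQ nc] naQ] <-]]; first by exists Q.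
  exists Q; last by rewrite segm.
  apply/singular_pointP; split; last by rewrite total_points //; apply: pcross.
  by split=> //; apply: stage_points.
move=> [Q sQ <-]; have [[naQ stQ] cQ] := (singular_pointP C Q).1 sQ.
(* If the segment is a base edge, injectivity shows that Q itself is the base point, and a model
   point is not active. *)
have [[Q' bQ' e]|nb] := pselect (base_edge C (segment Q)).
  have pQ' := bQ'.1; rewrite segm // in e.
  have eQ := segment_inj stQ (stage_points pQ') cQ (esym e).
  by right; exists Q; rewrite ?segm // eQ //; split=> //; rewrite -eQ.
left; split=> //; last by exists Q.
have cur : current Q = total Q.
  have [pQ|npQ] := pselect (points C Q); last by rewrite total_not_points.
  rewrite total_points // not_base_point // => bQ.
  by apply: nb; exists Q => //; rewrite segm.
have [v [w [_ sv _ _]]] := segment_pair stQ cQ.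
split; first by exists v.
case/lastP: Q sQ naQ stQ cQ nb cur sv => [|P t] sQ naQ stQ cQ nb cur sv.
  have [I [J [_ e]]] := cross_pair cQ.
  by case: (@current_origin _ C I); rewrite cur e; left.
have aP := (stage_rconsP C P t).1 stQ.
(* No branch at Q is new, so each end of the segment is E_P or already passes through P: the segment
   is a side of the petal of P. *)
exists (petal_at C P); first by right; exists P.
move=> u /(segmentP _ stQ)[lu [I gI]].
have cI : current (rcons P t) I by rewrite cur; apply: germ_total gI.
case: (germ_inv gI) => [[P' [t' [-> /rcons_inj[-> _] _]]]|e|]; first by left.
  by move: lu; rewrite e => /lotus_vertexB[_ _ []].
move=> [P' [t' [K [/rcons_inj[<- <-] gK tK]]]]; right; split=> //; exists K => //.
exact: germ_cross gK.
Qed.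

Lemma lateral_boundary_vertices : vertices (lateral_boundary C) = lotus_vertex.
Proof.
have -> : vertices (lateral_boundary C) = \bigcup_(e in edges (lateral_boundary C)) e by [].
rewrite lateral_boundary_edges; apply/seteqP; split=> v.
  by move=> [_ [Q sQ <-] /(segmentP _ (singular_stage sQ))[]].
move=> lv; have [Q [I [sQ gI]]] := lotus_vertex_singular lv.
exists (segment Q); first by exists Q.
by apply/(segmentP _ (singular_stage sQ)); split=> //; exists I.
Qed.

(* A base vertex lives at a point which may be blown up, while the corresponding
   component of the total transform is recorded at the unique point of the model
   through which its strict transform passes. *)
Definition represents v w : Prop :=
  if v is Exc P then w = Exc P else
  exists Q I, [/\ model_point C Q, germ_of v Q I & w = Bra Q I].

Lemma model_point_antichain Q Q' : model_point C Q -> model_point C Q' ->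
  ile Q Q' -> Q = Q'.
Proof.
by move=> [naQ _] [_ h] l; apply: contrapT => ne; apply: naQ; apply: h.
Qed.

Lemma germ_model_branch Q J Q' I : model_point C Q -> model_point C Q' ->
  germ_of (Bra Q J) Q' I -> Q' = Q /\ I = J.
Proof.
move=> mQ mQ' g; have e := model_point_antichain mQ mQ' (germ_bound g).
rewrite -e in g *; split=> //; case: (germ_inv g) => [[P [t []]]//|[->//]|].
move=> [P [t [K [eQ /germ_bound gK _]]]].
by have := ile_size gK; rewrite eQ size_rcons ltnn.
Qed.

Lemma represents_exists v : exists w, lotus_vertex v -> represents v w.
Proof.
have [lv|nlv] := pselect (lotus_vertex v); last by exists v.
case: v lv => [P|P I] lv; first by exists (Exc P).
have [Q [J [sQ gJ]]] := lotus_vertex_singular lv.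
by exists (Bra Q J) => _; exists Q, J; split=> //; case: sQ.
Qed.

Lemma represents_component v w : lotus_vertex v -> represents v w -> component C w.
Proof.
move=> lv; case: v lv => [P|P I] lv /= h.
  rewrite h; split; first by apply/lotus_vertexE.
  by move=> Q J [_ sQ]; apply: germ_total.
case: h => Q [J [mQ gJ ->]]; have [naQ stQ] := mQ.
have TJ := germ_total lv stQ gJ.
split=> /=.
  split=> //; first by case: TJ => [P' [_ _ []]].
  move=> P' gP'; have aP' : active C P' by apply: stQ; apply: (germ_bound gP').
  by have := germ_inj lv ((lotus_vertexE C P').2 aP') stQ gJ gP'.
by move=> Q' I' mQ' /(germ_model_branch mQ mQ')[-> ->].
Qed.

Lemma represents_germ v w Q I : lotus_vertex v -> represents v w ->
  model_point C Q -> (germ_of w Q I <-> germ_of v Q I).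
Proof.
move=> lv; case: v lv => [P|P K] lv /= h mQ; first by rewrite h.
have [Q' [J [mQ' gJ ->]]] := h; split=> g.
  by have [-> ->] := germ_model_branch mQ' mQ g.
(* Two distinct model points are incomparable, and a curve through both would be exceptional by
   [passes_fork]. *)
have e : Q = Q'; last first.
  by rewrite -e in gJ *; rewrite (germ_fun lv mQ.2 g gJ); apply: germ_bra.
have [k|k|[P' [t [t' [tt' k k']]]]] := ile_total_or_fork Q Q'.
- exact: model_point_antichain k.
- by symmetry; apply: model_point_antichain k.
by have := passes_fork lv mQ.2 mQ'.2 (ex_intro _ _ g) (ex_intro _ _ gJ) k k' tt'.
Qed.

Lemma represents_inj v v' w : lotus_vertex v -> lotus_vertex v' ->
  represents v w -> represents v' w -> v = v'.
Proof.
case: v => [P|P I]; case: v' => [P'|P' I'] lv lv' /=.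
- by move=> -> [->].
- by move=> -> [? [? []]].
- by move=> [? [? [_ _ ->]]].
move=> [Q [J [mQ gJ ->]]] [Q' [J' [_ gJ' [e e']]]].
by rewrite -e -e' in gJ'; apply: (germ_inj lv lv' mQ.2 gJ gJ').
Qed.

Lemma component_represented w : component C w ->
  exists2 v, lotus_vertex v & represents v w.
Proof.
case: w => [P|Q J] [/= mw h].
  by exists (Exc P) => //; apply/lotus_vertexE.
have [mQ bJ nE] := mw; have TJ := h Q J mQ (germ_bra Q J).
have [v lv gv] := germ_exists mQ.2 TJ; exists v => //.
case: v lv gv => [P|P I] lv gv; first by case: (nE P).
by exists Q, J.
Qed.

Theorem lateral_boundary_iso : exists (phi : curve R -> curve R)
    (psi : set (curve R) -> ipoint R),
  graph_isomorphism (lateral_boundary C) (dual_graph C) phi psi /\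
  forall P, active C P -> phi (Exc P) = Exc P.
Proof.
have [phi hphi] := choice represents_exists.
(* An inverse of [segment] on the singular points; any other set of vertices is sent to the
   origin. *)
have /choice[psi hpsi] (s : set (curve R)) : exists Q, forall Q',
    singular_point C Q' -> s = segment Q' -> Q = Q'.
  have [[Q sQ eQ]|h] := pselect (exists2 Q, singular_point C Q & s = segment Q).
    exists Q => Q' sQ' eQ'; have [mQ cQ] := (singular_pointP C Q).1 sQ.
    by apply: segment_inj cQ _; [case: mQ | apply: singular_stage | rewrite -eQ].
  by exists [::] => Q' sQ' eQ'; case: h; exists Q'.
have psiE Q : singular_point C Q -> psi (segment Q) = Q.
  by move=> sQ; apply: hpsi.
exists phi, psi; split; last first.
  by move=> P aP; have /= := hphi (Exc P) ((lotus_vertexE C P).2 aP).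
split.
- rewrite lateral_boundary_vertices; split=> [v lv|v v' /set_mem lv /set_mem lv' e|w cw].
  + exact: represents_component (hphi v lv).
  + by have r := hphi v lv; rewrite e in r; apply: (represents_inj lv lv' r (hphi v' lv')).
  (* [phi v] is a chosen representative of [v]; it equals [w] because [v] has one germ at one model
     point only. *)
  have [v lv rv] := component_represented cw; exists v => //.
  case: v lv rv => [P|P I] lv rv; first by have /= := hphi _ lv; rewrite rv.
  have := hphi _ lv => -[Q [J [mQ gJ e]]]; rewrite e.
  have [Q' [J' [mQ' gJ' ->]]] := rv.
  have := (represents_germ J' lv (hphi _ lv) mQ').2 gJ'; rewrite e.
  by move=> /(germ_model_branch mQ mQ')[-> ->].
- rewrite lateral_boundary_edges; split.
  + by move=> _ [Q sQ <-]; rewrite psiE.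
  + by move=> s s' /set_mem[Q sQ <-] /set_mem[Q' sQ' <-]; rewrite !psiE // => ->.
  + by move=> Q sQ; exists (segment Q); [exists Q | apply: psiE].
rewrite lateral_boundary_edges => _ [Q sQ <-]; rewrite psiE //=.
have mQ : model_point C Q by case: sQ.
apply/seteqP; split=> [w [cw [I TI gI]]|_ [v /(segmentP _ (singular_stage sQ))[lv [I gI]] <-]].
  have [v lv rv] := component_represented cw.
  have gv := (represents_germ I lv rv mQ).1 gI.
  exists v; first by apply/(segmentP _ (singular_stage sQ)); split=> //; exists I.
  case: v lv rv gv => [P|P K] lv rv gv; first by have /= := hphi _ lv; rewrite rv.
  have [Q' [J' [mQ' gJ' e']]] := rv.
  rewrite e' in gI *; have [eQ eI] := germ_model_branch mQ' mQ gI.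
  have [Q2 [J2 [mQ2 gJ2 e2]]] := hphi _ lv; rewrite e2.
  have := (represents_germ I lv (hphi _ lv) mQ).2 gv; rewrite e2.
  by move=> /(germ_model_branch mQ2 mQ)[<- <-]; rewrite eQ eI.
have rv := hphi v lv; split; first exact: represents_component rv.
exists I; first exact: germ_total lv mQ.2 gI.
exact/(represents_germ I lv rv mQ).
Qed.

End Isomorphism.

(** * Self-intersection numbers *)

Section OrderAlong.
Variable R : realType.
Notation S := (series R).
Notation K := R[i].
Implicit Types (F G a b e w : S) (t : direction R) (k n p : nat).

(* The curve [Exc P] is [{x = 0}] at the points [rcons P t] and [{y = 0}] at
   the infinitely near points of [rcons P t] through which it passes; these two
   cases are numbered [0] and [k.+1]. *)
Definition axis k : S := if k is 0%N then sX R else @sY R.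
Definition axis_direction k : direction R := if k is 0%N then None else Some 0.

Definition axis_coef k F : nat -> K :=
  if k is 0%N then fun l => F 0%N l else fun l => F l 0%N.

Definition vanishing_order (c : nat -> K) n : Prop :=
  (forall l, (l < n)%N -> c l = 0) /\ c n != 0.

Lemma vanishing_order_uniq c m n :
  vanishing_order c m -> vanishing_order c n -> m = n.
Proof.
move=> [hm cm] [hn cn]; case: (ltngtP m n) => // h.
  by rewrite hn ?eqxx in cm.
by rewrite hm ?eqxx in cn.
Qed.

Lemma vanishing_order_exists c : ~ (forall l, c l = 0) -> exists n, vanishing_order c n.
Proof.
move=> /existsNP[m /eqP cm].
case: (ex_minnP (ex_intro (fun m => c m != 0) m cm)) => n cn nmin; exists n; split=> // l ln.
by apply: contraTeq ln => /nmin; rewrite -leqNgt.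
Qed.

Lemma restrictM k F G l :
  axis_coef k (F * G) l = \sum_(j < l.+1) axis_coef k F j * axis_coef k G (l - j)%N.
Proof.
by case: k => [|k] /=; rewrite coefsM ?big_ord1 //; apply: eq_bigr => j _; rewrite big_ord1.
Qed.

Lemma vanishing_orderM (c d : nat -> K) m n :
  vanishing_order c m -> vanishing_order d n ->
  vanishing_order (fun l => \sum_(j < l.+1) c j * d (l - j)%N) (m + n).
Proof.
move=> [hc cm] [hd dn]; split=> [l ln|].
  apply: big1 => -[j /= hj] _; have [jm|mj] := ltnP j m; first by rewrite hc ?mul0r.
  by rewrite hd ?mulr0 //; move: hj mj ln; clear; lia.
rewrite (bigD1 (inord m)) //= big1 ?addr0.
  by rewrite inordK ?ltnS ?leq_addr // addKn mulf_neq0.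
move=> j; rewrite -val_eqE /= inordK ?ltnS ?leq_addr // => jm.
have [lt|ge] := ltnP j m; first by rewrite hc ?mul0r.
by rewrite hd ?mulr0 //; have := ltn_ord j; move: jm ge; clear; lia.
Qed.

Lemma restrict_vanishingM k F G m n : vanishing_order (axis_coef k F) m ->
  vanishing_order (axis_coef k G) n -> vanishing_order (axis_coef k (F * G)) (m + n).
Proof.
move=> hF hG; have [h1 h2] := vanishing_orderM hF hG.
by split=> [l ln|]; rewrite restrictM // h1.
Qed.

Lemma restrict_axisM k F l : axis_coef k (axis k * F) l = 0.
Proof. by case: k => [|k] /=; rewrite ?coefs_XM ?coefs_YM. Qed.

Lemma smooth_axis k : smooth (axis k).
Proof. by case: k => [|k]; [apply: smooth_sX | apply: smooth_sY]. Qed.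

Lemma convergent_axis k : convergent (axis k).
Proof. by case: (smooth_axis k). Qed.

Lemma axis_inj k : injective (fun F => axis k * F).
Proof. by case: k => [|k]; [apply: sX_inj | apply: sY_inj]. Qed.

Lemma axisX_inj k p : injective (fun F => axis k ^+ p * F).
Proof.
elim: p => [|p IH] F G /=; first by rewrite expr0 !mul1r.
by rewrite exprS -!mulrA => /axis_inj/IH.
Qed.

(* Meaningful only when the equation of the axis divides F. *)
Definition div_axis k F : S := if k is 0%N then sdivX F else sswap (sdivX (sswap F)).

Lemma convergent_div_axis k F : convergent F -> convergent (div_axis k F).
Proof.
case: k => [|k] cF /=; first exact: convergent_divX.
by apply/convergent_swap/convergent_divX/convergent_swap.
Qed.

Lemma axisM_div k F i j : (axis k * div_axis k F) i j =
  if (if k is 0%N then i else j) is 0%N then 0 else F i j.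
Proof.
by case: k => [|k] /=; rewrite ?coefs_XM ?coefs_YM; [case: i | case: j].
Qed.

(** Modulo the equation of the axis, F reduces to its restriction to the axis, so the order in the
    quotient ring is that of a power series in one variable. *)
Lemma order_onP k F n : convergent F ->
  order_on (axis k) F n <-> vanishing_order (axis_coef k F) n.
Proof.
move=> cF; have cD := convergent_div_axis k cF.
split=> [[[w cw h] h']|[h h']].
  have van l : (l < n)%N -> axis_coef k F l = 0.
    move=> ln; rewrite -(restrict_axisM k w l).
    by case: k h {h' cD} => [|k] h /=; rewrite h ?add0n ?addn0.
  split=> //; apply/eqP => h0; apply: h'; exists (div_axis k F) => // i j ij.
  rewrite smulE axisM_div.
  have {}van l : (l < n.+1)%N -> axis_coef k F l = 0.
    by rewrite ltnS leq_eqVlt => /orP[/eqP ->|/van].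
  case: k van {h h0 cD} => [|k] van; first by case: i ij => // ij; apply: van.
  by case: j ij => // ij; apply: van; rewrite -(addn0 i).
split.
  exists (div_axis k F) => // i j ij; rewrite smulE axisM_div.
  case: k h {h' cD} => [|k] van; first by case: i ij => // ij; apply: van.
  by case: j ij => // ij; apply: van; rewrite -(addn0 i).
move=> [w cw hw]; move/eqP: h'; apply; rewrite -(restrict_axisM k w n).
by case: k {h cD} hw => [|k] hw /=; rewrite hw ?add0n ?addn0.
Qed.

Lemma order_on_ideal e e' F n : ideal e = ideal e' -> order_on e F n -> order_on e' F n.
Proof.
move=> ee; rewrite /order_on.
have h m : (exists2 w, convergent w & eq_jet m F (smul e w)) <->
    (exists2 w, convergent w & eq_jet m F (smul e' w)).
  split=> -[w cw hw].
    have [v cv' ev] : ideal e' (smul e w) by rewrite -ee; exists w.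
    by exists v => //; rewrite -ev.
  have [v cv' ev] : ideal e (smul e' w) by rewrite ee; exists w.
  by exists v => //; rewrite -ev.
by move=> [/h h1 h2]; split=> // /h.
Qed.

Definition order_along k F p n : Prop := exists G,
  [/\ convergent G, F = axis k ^+ p * G & vanishing_order (axis_coef k G) n].

Lemma order_along_uniq k F p n p' n' :
  order_along k F p n -> order_along k F p' n' -> p = p' /\ n = n'.
Proof.
have aux q m q' m' : order_along k F q m -> order_along k F q' m' -> (q < q')%N -> False.
  move=> [G [_ -> [_ Gm]]] [G' [_ e _]] lt; move: e Gm.
  rewrite -(subnKC lt) exprD exprSr -!mulrA => /axisX_inj ->.
  by rewrite restrict_axisM eqxx.
move=> h h'; have e : p = p'.
  by case: (ltngtP p p') => // lt; exfalso; [apply: aux h h' lt | apply: aux h' h lt].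
split=> //; case: h => G [_ eF hG]; case: h' => G' [_ + hG']; rewrite eF e => /axisX_inj eG.
by apply: vanishing_order_uniq hG _; rewrite eG.
Qed.

Lemma order_along_neq0 k p n : ~ order_along k 0 p n.
Proof.
move=> [G [_ + [_]]]; rewrite -(mulr0 (axis k ^+ p)) => /axisX_inj <-.
by case: k => [|k]; rewrite eqxx.
Qed.

Lemma restrict00 k F : axis_coef k F 0%N = F 0%N 0%N.
Proof. by case: k. Qed.

(** The local equation in [section_order] is an arbitrary generator; it differs from the coordinate
    by a unit, which changes no order. *)
Lemma section_orderP k a b m : section_order (ideal (axis k)) a b m <->
  exists p ma mb, [/\ order_along k a p.+1 ma, order_along k b p mb & m = mb%:Z - ma%:Z].
Proof.
have cE := convergent_axis k; split.
  move=> [e [a' [b' [p [ma [mb [[ce ca cb] eI [-> ->] _ [oa ob ->]]]]]]]].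
  have [w cw ew] : ideal (axis k) e by rewrite eI; apply: ideal_self.
  have [v cv' ev] : ideal e (axis k) by rewrite -eI; apply: ideal_self.
  have w0 : w 0%N 0%N != 0.
    have : w * v = 1 by apply: (@axis_inj k); rewrite /= mulr1 {2}ev !smulE ew smulE mulrA.
    move=> /(congr1 (fun F : S => F 0%N 0%N)); rewrite coefsM00 coefs1 => /= wv.
    by apply/eqP => w0; move/eqP: wv; rewrite w0 mul0r eq_sym oner_eq0.
  have vw q : vanishing_order (axis_coef k (w ^+ q)) 0%N.
    by split=> //; rewrite restrict00 coefs00X expf_neq0.
  have cwq q : convergent (w ^+ q) by apply: convergentX.
  exists p, ma, mb; split=> //.
    exists (w ^+ p.+1 * a'); split; first exact: convergentM.
      by rewrite smulE sexpE ew smulE exprMn mulrA.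
    apply: (@restrict_vanishingM k _ _ 0%N ma) => //; apply/order_onP => //.
    by apply: order_on_ideal oa; rewrite eI.
  exists (w ^+ p * b'); split; first exact: convergentM.
    by rewrite smulE sexpE ew smulE exprMn mulrA.
  apply: (@restrict_vanishingM k _ _ 0%N mb) => //; apply/order_onP => //.
  by apply: order_on_ideal ob; rewrite eI.
move=> [p [ma [mb [[a' [ca -> va]] [b' [cb -> vb]] ->]]]].
have nI F n : vanishing_order (axis_coef k F) n -> ~ ideal (axis k) F.
  by move=> [_ Fn] [w cw e]; move: Fn; rewrite e smulE restrict_axisM eqxx.
exists (axis k), a', b', p, ma, mb; split=> //.
- by rewrite !smulE !sexpE.
- by split; [apply: nI va | apply: nI vb].
- by split=> //; apply/order_onP.
Qed.

End OrderAlong.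

(** * Leading forms, their zeros, and orders after further blowups *)

Section LeadingForm.
Variable R : realType.
Notation S := (series R).
Notation K := R[i].
Implicit Types (F A B : S) (t : direction R) (p : nat).

Definition leading_degree A p : Prop :=
  (forall i j, (i + j < p)%N -> A i j = 0) /\
  exists2 i, (i <= p)%N & A i (p - i)%N != 0.

Lemma leading_degree_exists A : A <> 0 -> exists p, leading_degree A p.
Proof.
move=> nA; pose P m := `[< exists2 i, (i <= m)%N & A i (m - i)%N != 0 >].
have exP : exists m, P m.
  apply: contrapT => h; apply: nA; apply: seriesP => i j; apply: contrapT => /eqP Aij.
  by apply: h; exists (i + j)%N; apply/asboolP; exists i; rewrite ?leq_addr // addKn.
case: (ex_minnP exP) => p /asboolP hp pmin; exists p; split=> // i j ij.
apply: contrapT => /eqP Aij; have : P (i + j)%N.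
  by apply/asboolP; exists i; rewrite ?leq_addr // addKn.
by move=> /pmin; rewrite leqNgt ij.
Qed.

Lemma leading_degree_sXM B p : leading_degree B p -> leading_degree (sX R * B) p.+1.
Proof.
move=> [h [i ip Bi]]; split.
  by move=> [|i'] j; rewrite coefs_XM // addSn ltnS => /h.
by exists i.+1; rewrite ?coefs_XM.
Qed.

Lemma vanishing_order_polyM (q r : {poly K}) m n :
  vanishing_order (fun l => q`_l) m -> vanishing_order (fun l => r`_l) n ->
  vanishing_order (fun l => (q * r)`_l) (m + n).
Proof.
move=> hq hr; have [h1 h2] := vanishing_orderM hq hr.
by split=> [l ln|]; rewrite coefM // h1.
Qed.

Lemma vanishing_order_prod_XsubC (c : K) (rs : seq K) :
  vanishing_order (fun l => (\prod_(z <- rs) ('X - (z - c)%:P))`_l) (count_mem c rs).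
Proof.
elim: rs => [|z rs IH].
  by rewrite big_nil; split=> //; rewrite coef1 oner_eq0.
rewrite big_cons /=; apply: vanishing_order_polyM => //.
have [->|zc] := eqVneq z c.
  by rewrite subrr subr0; split=> [[|l]|] //; rewrite coefX ?oner_eq0.
split=> //; by rewrite coefB coefX coefC /= sub0r oppr_eq0 subr_eq0.
Qed.

(** In the chart (1, c + v) a form is dehomogenized by x = 1 and translated by c; its zeros away
    from the direction (0 : 1) are the roots of this polynomial. *)
Lemma homog_chart (c : K) p A : homog (Some c) p A =
  (\poly_(j < p.+1) A (p - j)%N j) \Po ('X + c%:P).
Proof.
rewrite poly_def /homog rmorph_sum /= (reindex_inj rev_ord_inj) /=.
apply: eq_bigr => j _; rewrite subSS expr1n mul1r linearZ /= rmorphXn /= comp_polyX.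
by rewrite addrC subKn // -ltnS.
Qed.

Lemma homog_none p A l : (homog None p A)`_l = if (l <= p)%N then A l (p - l)%N else 0.
Proof.
rewrite /homog coef_sum /=.
under eq_bigr do rewrite expr1n mulr1 coefZ coefXn.
case: leqP => lp; last first.
  rewrite big1 // => i _; case: eqP => [e|]; last by rewrite mulr0.
  by have := ltn_ord i; rewrite -e ltnS leqNgt lp.
rewrite (bigD1 (inord l)) //= inordK // eqxx mulr1 big1 ?addr0 // => i.
by rewrite -val_eqE /= inordK // eq_sym => /negPf ->; rewrite mulr0.
Qed.

(* The list zs of the zeros of the leading form on E_P, with multiplicities. *)
Lemma leading_form_zeros A p : leading_degree A p ->
  exists2 zs : seq (direction R), size zs = p &
  forall t, vanishing_order (fun l => (homog t p A)`_l) (count_mem t zs).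
Proof.
move=> [_ [i ip Ai]]; pose h := \poly_(j < p.+1) A (p - j)%N j.
have hj j : h`_j = if (j < p.+1)%N then A (p - j)%N j else 0 by rewrite coef_poly.
have h0 : h != 0.
  apply: contraNneq Ai => h0; have := hj (p - i)%N; rewrite h0 coef0 ltnS leq_subr subKn //.
  by move=> <-.
have sh : (0 < size h <= p.+1)%N by rewrite size_poly_gt0 h0 size_poly.
have [rs ers] := closed_field_poly_normal h.
have srs : size h = (size rs).+1.
  rewrite ers size_scale ?lead_coef_eq0 // size_prod_XsubC //.
(* The degree of [h] is [size h] minus one; what it lacks to reach p is the multiplicity of the zero
   in the direction (0 : 1). *)
exists (nseq (p.+1 - size h) None ++ map Some rs).
  by rewrite size_cat size_nseq size_map srs subSS subnK //; move: sh; rewrite srs; case/andP.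
move=> t; rewrite count_cat count_nseq count_map.
case: t => [c|] /=; last first.
  rewrite mul1n (@eq_count _ _ pred0) // count_pred0 addn0.
  have lt : (p.+1 - size h <= p)%N by move: (size h) sh => m; clear; lia.
  have es : (p - (p.+1 - size h) = (size h).-1)%N by move: (size h) sh => m; clear; lia.
  split=> [l ln|]; rewrite homog_none.
    case: leqP => // lp; have := hj (p - l)%N; rewrite ltnS leq_subr subKn // => <-.
    by rewrite nth_default //; move: (size h) ln lp sh => m; clear; lia.
  rewrite lt; have := hj (p - (p.+1 - size h))%N; rewrite ltnS leq_subr subKn // => <-.
  by rewrite es -lead_coefE lead_coef_eq0.
rewrite mul0n add0n homog_chart -/h ers linearZ /= rmorph_prod /=.
rewrite (eq_bigr (fun z => 'X - (z - c)%:P)); last first.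
  move=> z _; rewrite rmorphB /= comp_polyX comp_polyC polyCB.
  by rewrite opprB addrA.
rewrite (@eq_count _ _ (pred1 c)); last by move=> z.
have [h1 h2] := vanishing_order_prod_XsubC c rs.
split=> [l ln|]; rewrite coefZ; first by rewrite h1 // mulr0.
by rewrite mulf_neq0 // lead_coef_eq0.
Qed.

Definition axis_directions k : seq (direction R) :=
  if k is k'.+1 then None :: nseq k' (Some 0) else [::].

Lemma axis_directionsS k : axis_directions k.+1 = rcons (axis_directions k) (axis_direction R k).
Proof. by case: k => [|k] //=; congr cons; elim: k => //= k ->. Qed.

Lemma pull_rcons s t F : pull (rcons s t) F = pull1 t (pull s F).
Proof. by rewrite /pull foldl_rcons. Qed.

Lemma convergent_pull s F : convergent F -> convergent (pull s F).
Proof.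
by move=> cF; elim/last_ind: s => // s t IH; rewrite pull_rcons; apply: convergent_pull1.
Qed.

Lemma pull1_axis k : pull1 (axis_direction R k) (axis R k) = sX R * @sY R.
Proof. by case: k => [|k] /=; rewrite ?pull1_sX // pull1_sY /= sconst0 add0r. Qed.

Lemma restrict_pull1_axis k F l : pull1 (axis_direction R k) F l 0%N = axis_coef k F l.
Proof.
rewrite pull1E; case: k => [|k] /=; first by rewrite homog_none leq0n subn0.
rewrite /homog coef_sum /= (bigD1 ord_max) //= subnn expr1n mul1r expr0 coefZ coef1 mulr1.
rewrite big1 ?addr0 // => i; rewrite -val_eqE /= => il; rewrite expr1n mul1r add0r coefZ coefXn.
rewrite (_ : (0 == l - i)%N = false) ?mulr0 //.
by have := ltn_ord i; move: il; clear; lia.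
Qed.

(** The first blowup gives u^p times a series restricting to the leading form on E. At each further
    point of E, e^p becomes (u v)^p with v the new equation of E; the factor u^p adds p to the order
    on E, and the restriction of the remaining factor is unchanged. *)
Lemma order_along_axis_directions A p t n k : convergent A -> leading_degree A p ->
  vanishing_order (fun l => (homog t p A)`_l) n ->
  order_along k (pull (t :: axis_directions k) A) p (n + k * p).
Proof.
move=> cA [hA _] hn; elim: k => [|k [G [cG eG vG]]].
  exists (fun i j => pull1 t A (i + p)%N j); split.
  - have : forall q, convergent (fun i j => pull1 t A (i + q)%N j).
      elim=> [|q IH]; last first.
        have := convergent_divX IH; rewrite /sdivX.
        by under eq_fun do under eq_fun do rewrite addSnnS.
      by under eq_fun do under eq_fun do rewrite addn0; apply: convergent_pull1.
    by [].
  - have shift q : forall F, (forall i j, (i < q)%N -> F i j = 0) ->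
        F = sX R ^+ q * (fun i j => F (i + q)%N j) :> S.
      elim: q => [|q IH] F hF.
        by rewrite expr0 mul1r; apply: seriesP => i j; rewrite addn0.
      rewrite exprS -mulrA {1}(sdivXK (a := F)); last by move=> j; apply: hF.
      rewrite {1}(IH (sdivX F)); last by move=> i j iq; apply: hF.
      by congr (_ * (_ * _)); apply: seriesP => i j; rewrite /sdivX addnS.
    apply: (shift p (pull1 t A)) => i j ip; rewrite pull1E /homog big1 ?coef0 // => m _.
    by rewrite hA ?scale0r //; have := ltn_ord m; move: ip; clear; lia.
  by rewrite mul0n addn0.
rewrite axis_directionsS -rcons_cons pull_rcons eG pull1M pull1X pull1_axis exprMn.
exists (sX R ^+ p * pull1 (axis_direction R k) G); split.
- by cv.
- by rewrite mulrA [axis R _ ^+ _ * _]mulrC.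
rewrite mulSn addnCA; apply: restrict_vanishingM.
  have -> : p = (p * 1)%N by rewrite muln1.
  elim: p {hA hn eG vG} => [|p IH]; 
    first by rewrite mul0n expr0; split=> //=; rewrite coefs1 oner_eq0.
  rewrite mulSn [sX R ^+ _]exprS; apply: restrict_vanishingM; last first.
    by move: IH; rewrite muln1.
  by split=> [[|l]|] //=; rewrite /sX /= oner_eq0.
have [v1 v2] := vG.
by split=> [l ln|] /=; rewrite restrict_pull1_axis // v1.
Qed.

End LeadingForm.

(** * Local coordinates as quotients of pull-backs *)

Section Coordinates.
Variable R : realType.
Notation S := (series R).
Implicit Types (F a b : S) (t : direction R).

Lemma series_factor F : F <> 0 -> exists p G,
  F = sX R ^+ p * G /\ ~ (forall l, axis_coef 0 G l = 0).
Proof.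
move=> nF; pose P i := `[< exists j, F i j != 0 >].
have exP : exists i, P i.
  apply: contrapT => h; apply: nF; apply: seriesP => i j; apply: contrapT => /eqP Fij.
  by apply: h; exists i; apply/asboolP; exists j.
case: (ex_minnP exP) => p /asboolP[j Fpj] pmin.
have {pmin} : forall i k, (i < p)%N -> F i k = 0.
  move=> i k ip; apply: contrapT => /eqP Fik; have : P i by apply/asboolP; exists k.
  by move=> /pmin; rewrite leqNgt ip.
elim: p F Fpj {nF P exP} => [|p IH] F Fpj h.
  by exists 0%N, F; split; [rewrite expr0 mul1r | move=> /(_ j) /eqP; apply/negP].
have [|q [G [e nG]]] := IH (sdivX F) Fpj; first by move=> i k ip; apply: h.
exists q.+1, G; split=> //.
by rewrite exprS -mulrA -e; apply: sdivXK => k; apply: h.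
Qed.

Lemma series_mul_neq0 a b : a <> 0 -> b <> 0 -> a * b <> 0.
Proof.
move=> /series_factor[p [G [-> /vanishing_order_exists[m hm]]]].
move=> /series_factor[q [H [-> /vanishing_order_exists[n hn]]]].
rewrite mulrACA -exprD -(mulr0 (sX R ^+ (p + q))).
move=> /(@axisX_inj R 0) e; have [_] := restrict_vanishingM hm hn.
by rewrite e eqxx.
Qed.

Lemma pull1_neq0 t a : a <> 0 -> pull1 t a <> 0.
Proof.
move=> /leading_degree_exists[p /leading_form_zeros[zs _ /(_ t)[_ h]]] e.
by move: h; rewrite -pull1E e eqxx.
Qed.

Lemma pull_cat s s' a : pull (s ++ s') a = pull s' (pull s a).
Proof. by rewrite /pull foldl_cat. Qed.

(* The local coordinates at an infinitely near point are quotients of pull-backs,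
   since they are rational functions of the coordinates at the origin. *)
Lemma coordinates_pull (P : ipoint R) : forall k, exists a b,
  [/\ convergent a, convergent b, pull P b <> 0 & pull P a = axis R k * pull P b].
Proof.
elim/last_ind: P => [|P t IH] k.
  exists (axis R k), 1; split=> /=.
  - exact: convergent_axis.
  - exact: convergent1.
  - by apply/eqP; apply: oner_neq0.
  - by rewrite mulr1.
have [a1 [b1 [ca1 cb1 nb1 e1]]] := IH 0%N; have [a2 [b2 [ca2 cb2 nb2 e2]]] := IH 1%N.
have pullM s a b : pull s (a * b) = pull s a * pull s b.
  by elim/last_ind: s => // s u IHs; rewrite !pull_rcons IHs pull1M.
have pullB s a b : pull s (a - b) = pull s a - pull s b.
  by elim/last_ind: s => // s u IHs; rewrite !pull_rcons IHs pull1D pull1N.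
have pullC s c : pull s (sconst c) = sconst c.
  by elim/last_ind: s => // s u IHs; rewrite pull_rcons IHs pull1_const.
have X0 : sX R <> 0 by apply: smooth_neq0; apply: smooth_sX.
have Y0 : @sY R <> 0 by apply: smooth_neq0; apply: smooth_sY.
have n1 : pull P a1 <> 0 by rewrite e1; apply: series_mul_neq0.
have n2 : pull P a2 <> 0 by rewrite e2; apply: series_mul_neq0.
have E1 : pull (rcons P t) a1 = sX R * xfac t * pull (rcons P t) b1.
  by rewrite !pull_rcons e1 pull1M pull1_sX.
have E2 : pull (rcons P t) a2 = sX R * yfac t * pull (rcons P t) b2.
  by rewrite !pull_rcons e2 pull1M pull1_sY.
(* The formulas are u = x, v = y/x - c in the direction (1 : c), and u = y, v = x/y in the direction
   (0 : 1), with x = a1/b1 and y = a2/b2. *)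
case: t E1 E2 => [c|] E1 E2; case: k => [|k] /=.
- exists a1, b1; split=> //; first by rewrite pull_rcons; apply: pull1_neq0.
  by rewrite E1 /= mulr1.
- exists (a2 * b1 - sconst c * (a1 * b2)), (a1 * b2); split; [cv | cv | |].
    by rewrite pull_rcons pullM; apply: pull1_neq0; apply: series_mul_neq0.
  by rewrite pullB !pullM pullC E1 E2 /=; ring.
- exists a2, b2; split=> //; first by rewrite pull_rcons; apply: pull1_neq0.
  by rewrite E2 /= mulr1.
- exists (a1 * b2), (a2 * b1); split; [cv | cv | |].
    by rewrite pull_rcons pullM; apply: pull1_neq0; apply: series_mul_neq0.
  by rewrite !pullM E1 E2 /=; ring.
Qed.

End Coordinates.

Lemma sum_count_mem (T : eqType) (r s : seq T) : uniq r -> {subset s <= r} ->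
  (\sum_(t <- r) count_mem t s = size s)%N.
Proof.
move=> ur; elim: s => [|x s IH] sr /=; first by rewrite big1.
rewrite big_split /= IH; last by move=> y ys; apply: sr; rewrite in_cons ys orbT.
rewrite -add1n; congr addn; transitivity (\sum_(t <- r | t == x) 1)%N.
  by rewrite [RHS]big_mkcond; apply: eq_bigr => t _; rewrite eq_sym; case: eqP.
by rewrite sum1_count count_uniq_mem // sr // mem_head.
Qed.

(** * Points of an exceptional curve, its self-intersection and its petals *)

Section Weight.
Variables (R : realType) (C : constellation R) (P : ipoint R).
Hypothesis aP : active C P.
Notation S := (series R).
Implicit Types (Q : ipoint R) (I J : set S) (t : direction R) (k : nat).

Definition exc_point t k : ipoint R := rcons P t ++ axis_directions R k.

Lemma exc_pointS t k : exc_point t k.+1 = rcons (exc_point t k) (axis_direction R k).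
Proof. by rewrite /exc_point axis_directionsS rcons_cat. Qed.

Lemma size_exc_point t k : size (exc_point t k) = ((size P).+1 + k)%N.
Proof.
elim: k => [|k IH]; first by rewrite /exc_point cats0 size_rcons addn0.
by rewrite exc_pointS size_rcons IH addnS.
Qed.

Lemma exc_point_direction t k : nth None (exc_point t k) (size P) = t.
Proof. by rewrite /exc_point cat_rcons nth_cat ltnn subnn. Qed.

Lemma exc_point_le t k k' : (k <= k')%N -> ile (exc_point t k) (exc_point t k').
Proof.
move=> /subnKC <-; elim: (k' - k)%N => [|n IH]; first by rewrite addn0; apply: ile_refl.
by rewrite addnS exc_pointS; apply/ile_rcons; right.
Qed.

Lemma strict_axis u k J : strict_transform u (ideal (axis R k)) J <->
  u = axis_direction R k /\ J = ideal (axis R k.+1).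
Proof.
have sa := smooth_axis R k; have [ca a0 _] := sa.
have ta : tangent (axis_direction R k) (axis R k).
  by rewrite /tangent pull1_axis coefs_XM.
have es : strict (axis_direction R k) (axis R k) = @sY R.
  by apply: sX_inj; rewrite /= -strictE // pull1_axis.
split=> [/(strict_transformP _ _ sa)[tu ->]|[-> ->]].
  by have -> := tangent_uniq sa tu ta; rewrite es.
by apply/(strict_transformP _ _ sa); rewrite es.
Qed.

Lemma germ_excP Q I : germ_of (Exc P) Q I <->
  exists t k, Q = exc_point t k /\ I = ideal (axis R k).
Proof.
split=> [|[t [k [-> ->]]]]; last first.
  elim: k => [|k IH]; first by rewrite /exc_point cats0; apply: germ_exc.
  by rewrite exc_pointS; apply: germ_strict IH _; apply/strict_axis.
elim/last_ind: Q I => [|Q u IH] I /germ_inv[].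
- by move=> [P' [t [_ /(congr1 size)]]]; rewrite size_rcons.
- by [].
- by move=> [P' [t [K [/(congr1 size)]]]]; rewrite size_rcons.
- by move=> [P' [t [[<-] -> ->]]]; exists t, 0%N; rewrite /exc_point cats0.
- by [].
move=> [P' [u' [K [/rcons_inj[<- <-] /IH[t [k [-> ->]]] /strict_axis[-> ->]]]]].
by exists t, k.+1; rewrite exc_pointS.
Qed.

(** The points of E_P over the direction [t] form a chain; the active ones are an initial part of
    it, finite because active words have bounded length. *)
Lemma exc_point_active t :
  exists d, forall k, active C (exc_point t k) <-> (k < d)%N.
Proof.
have [N hN] := active_bound C.
pose p k := `[< ~ active C (exc_point t k) >].
have exp : exists k, p k.
  exists N; apply/asboolP => /hN; rewrite size_exc_point; clear; lia.
case: (ex_minnP exp) => d /asboolP nd dmin; exists d => k; split=> [ak|kd].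
  rewrite ltnNge; apply/negP => dk; apply: nd.
  have [e|ne] := pselect (exc_point t d = exc_point t k); first by rewrite e.
  by apply: (stage_active ak); split=> //; apply: exc_point_le.
by apply: contrapT => nk; have := dmin k (asboolT nk); rewrite leqNgt kd.
Qed.

Lemma model_exc_point (d : direction R -> nat) t k :
  (forall t k, active C (exc_point t k) <-> (k < d t)%N) ->
  model_point C (exc_point t k) <-> k = d t.
Proof.
move=> hd; split=> [[na st]|->].
  apply/eqP; rewrite eqn_leq; apply/andP; split; last first.
    by rewrite leqNgt; apply/negP => /hd.
  case: k na st => // k na st; apply/hd; apply: st; rewrite exc_pointS.
  exact/ilt_rcons/ile_refl.
split; first by move=> /hd; rewrite ltnn.
case e : (d t) => [|m]; first by rewrite /exc_point cats0; apply/stage_rconsP.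
by rewrite exc_pointS; apply/stage_rconsP/hd; rewrite e.
Qed.

(** Blowing up points of E_P does not change it as a curve: on the model it still has one point per
    direction. *)
Lemma exceptional_pointsP (d : direction R -> nat) :
  (forall t k, active C (exc_point t k) <-> (k < d t)%N) ->
  set_bij [set: direction R] (exceptional_points C P) (fun t => exc_point t (d t)).
Proof.
move=> hd; split.
- move=> t _; split; first exact/model_exc_point.
  by exists (ideal (axis R (d t))); apply/germ_excP; exists t, (d t).
- by move=> t t' _ _ /(congr1 (fun Q => nth None Q (size P))); rewrite !exc_point_direction.
move=> Q [mQ [I /germ_excP[t [k [eQ _]]]]]; exists t => //.
by rewrite eQ; congr exc_point; symmetry; apply/model_exc_point => //; rewrite -eQ.
Qed.

(** Writing [d t] as a multiplicity in a list of directions puts the blown-up points on the same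
    footing as the zeros of the two leading forms. *)
Lemma count_active_points (d : direction R -> nat) (X : {fset ipoint R}) t :
  (forall t k, active C (exc_point t k) <-> (k < d t)%N) ->
  [set Q | active C Q /\ passes (Exc P) Q] = [set` X] ->
  count_mem t [seq nth None Q (size P) | Q <- X] = d t.
Proof.
move=> hd eX; rewrite count_map -size_filter.
have memX Q : Q \in X <-> active C Q /\ passes (Exc P) Q.
  by have := congr1 (fun A : set _ => A Q) eX => /= ->.
have -> : d t = size [seq exc_point t k | k <- iota 0 (d t)] by rewrite size_map size_iota.
apply: perm_size; apply: uniq_perm.
- by apply: filter_uniq; apply: fset_uniq.
- rewrite map_inj_uniq ?iota_uniq // => k k' /(congr1 size).
  by rewrite !size_exc_point => /addnI.
move=> Q; rewrite mem_filter; apply/andP/mapP => /= [[/eqP et /memX[aQ [I /germ_excP[t' [k [eQ _]]]]]]|].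
  rewrite eQ exc_point_direction in et; rewrite et in eQ; rewrite eQ in aQ *.
  by exists k => //; rewrite mem_iota add0n; apply/hd.
move=> [k]; rewrite mem_iota add0n => /hd ak ->; rewrite exc_point_direction eqxx.
split=> //; apply/memX; split=> //; exists (ideal (axis R k)); apply/germ_excP.
by exists t, k.
Qed.

(** Each local order is a combination of multiplicities of [t] in three lists; the sum over the
    projective line is therefore finite and gives the lengths of the lists. *)
Lemma sum_exceptional_points (d : direction R -> nat) (X : {fset ipoint R})
    (ord : ipoint R -> int) (zA zB : seq (direction R)) :
  (forall t k, active C (exc_point t k) <-> (k < d t)%N) ->
  [set Q | active C Q /\ passes (Exc P) Q] = [set` X] ->
  (forall t, ord (exc_point t (d t)) = (count_mem t zB)%:Z - (count_mem t zA)%:Z - (d t)%:Z) ->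
  finite_set (exceptional_points C P `&` [set Q | ord Q != 0]) /\
  \sum_(Q \in exceptional_points C P) ord Q = (size zB)%:Z - (size zA)%:Z - (#|` X|)%:Z.
Proof.
move=> hd eX ho; pose zX := [seq nth None Q (size P) | Q <- X].
have hX t : count_mem t zX = d t by apply: count_active_points.
pose r := undup (zA ++ zB ++ zX).
have ord0 t : t \notin r -> ord (exc_point t (d t)) = 0.
  rewrite mem_undup !mem_cat !negb_or => /and3P[nA nB nX].
  by rewrite ho -hX !(count_memPn _) // !subr0.
have bij := exceptional_pointsP hd.
split.
  apply: sub_finite_set (finite_seq [seq exc_point t (d t) | t <- r]).
  case: bij => _ _ surj Q [/surj[t _ <-]] /= ot; apply: map_f.
  by apply: contraNT ot => /ord0 ->.
rewrite (reindex_fsbig _ _ _ _ bij) -(fsbig_widen [set` r]) //; last first.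
  by move=> t [_ /= /negP nt]; apply: ord0.
rewrite -fsbig_seq ?undup_uniq //.
have sumZ (z : seq (direction R)) : {subset z <= r} ->
    \sum_(t <- r) (count_mem t z)%:Z = (size z)%:Z.
  move=> zr; rewrite -(sum_count_mem (undup_uniq _) zr).
  by rewrite (big_morph Posz PoszD (erefl 0%:Z)).
under eq_bigr do rewrite ho -hX.
rewrite !sumrB !sumZ ?size_map //; move=> z hz; rewrite mem_undup !mem_cat hz ?orbT //.
Qed.

Lemma local_orders (d : direction R -> nat) a p zs t :
  convergent a -> leading_degree (pull P a) p ->
  (forall t, vanishing_order (fun l => (homog t p (pull P a))`_l) (count_mem t zs)) ->
  order_along (d t) (pull (exc_point t (d t)) a) p (count_mem t zs + d t * p).
Proof.
move=> ca lp hz; rewrite /exc_point cat_rcons pull_cat.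
by apply: order_along_axis_directions => //; apply: convergent_pull.
Qed.

Lemma self_intersectionE (X : {fset ipoint R}) :
  [set Q | active C Q /\ passes (Exc P) Q] = [set` X] ->
  self_intersection C P = - (#|` X|.+1)%:Z.
Proof.
move=> eX; have [d hd] := choice exc_point_active.
have hdir t : model_point C (exc_point t (d t)) by apply/model_exc_point.
have hgerm t : germ_of (Exc P) (exc_point t (d t)) (ideal (axis R (d t))).
  by apply/germ_excP; exists t, (d t).
apply: xget_unique.
  (* Take for h = a/b the first local coordinate at P: the leading degrees are q + 1 and q, so h has
     multiplicity 1 along E_P. *)
  have [a [b [ca cb nb eab]]] := coordinates_pull P 0.
  have [q lq] := leading_degree_exists nb.
  have lp : leading_degree (pull P a) q.+1 by rewrite eab; apply: leading_degree_sXM.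
  have [zB szB hB] := leading_form_zeros lq; have [zA szA hA] := leading_form_zeros lp.
  pose ord Q : int := let t := nth None Q (size P) in
    (count_mem t zB)%:Z - (count_mem t zA)%:Z - (d t)%:Z.
  have ho t : ord (exc_point t (d t)) =
      (count_mem t zB)%:Z - (count_mem t zA)%:Z - (d t)%:Z.
    by rewrite /ord exc_point_direction.
  have [fin es] := sum_exceptional_points hd eX ho.
  exists a, b, ord; split=> //; last by rewrite es szA szB; clear; lia.
  move=> Q I mQ /germ_excP[t [k [eQ ->]]].
  have ek : k = d t by apply/model_exc_point => //; rewrite -eQ.
  rewrite eQ ek ho; apply/section_orderP.
  exists q, (count_mem t zA + d t * q.+1)%N, (count_mem t zB + d t * q)%N.
  split; [exact: local_orders | exact: local_orders |].
  by rewrite mulnS; clear; lia.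
(* Independence of the choice: for any admissible a/b the local orders are again given by zeros of
   leading forms, and multiplicity 1 forces the degrees to be q + 1 and q. *)
move=> n [a [b [ord [[ca cb] hs _ ->]]]].
have hso t := (section_orderP _ _ _ _).1 (hs _ _ (hdir t) (hgerm t)).
have pull_cat' t c : pull (exc_point t (d t)) c = pull (t :: axis_directions R (d t)) (pull P c).
  by rewrite /exc_point cat_rcons pull_cat.
have pull0 s : pull s 0 = 0 :> S.
  by elim/last_ind: s => // s u IH; rewrite pull_rcons IH pull10.
(* Any direction serves here: finite orders at one point show that neither pull-back to P is
   zero. *)
have [p0 [ma0 [mb0 [oa0 ob0 _]]]] := hso None.
have nA : pull P a <> 0.
  by move=> e; move: oa0; rewrite pull_cat' e pull0; apply: order_along_neq0.
have nB : pull P b <> 0.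
  by move=> e; move: ob0; rewrite pull_cat' e pull0; apply: order_along_neq0.
have [p lp] := leading_degree_exists nA; have [q lq] := leading_degree_exists nB.
have [zB szB hB] := leading_form_zeros lq; have [zA szA hA] := leading_form_zeros lp.
have key t : p = q.+1 /\
    ord (exc_point t (d t)) = (count_mem t zB)%:Z - (count_mem t zA)%:Z - (d t)%:Z.
  have [k [ma [mb [oa ob ->]]]] := hso t.
  have [e1 e2] := order_along_uniq oa (local_orders d t ca lp hA).
  have [e3 e4] := order_along_uniq ob (local_orders d t cb lq hB).
  split; first by rewrite -e1 -e3.
  by rewrite e2 e4 -e1 -e3 mulnS; clear; lia.
have [_ ->] := sum_exceptional_points hd eX (fun t => (key t).2).
by rewrite szA szB (key None).1; clear; lia.
Qed.

(** Every exceptional curve of the petal of Q other than E_Q is created strictly below Q, so the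
    petal, a set of vertices, determines Q. *)
Lemma petal_at_inj : {in [set Q | active C Q] &, injective (petal_at C)}.
Proof.
move=> Q Q' _ _ e.
have aux Q1 Q2 : petal_at C Q1 = petal_at C Q2 -> Q1 = Q2 \/ (size Q1 < size Q2)%N.
  move=> e'; have : petal_at C Q1 (Exc Q1) by left.
  rewrite e' => -[[->]|[_ [I _ gI]]]; first by left.
  by right; apply: ilt_size; apply: (germ_bound gI).
have [//|h] := aux _ _ e; have [//|h'] := aux _ _ (esym e).
by move: h'; rewrite ltnNge (ltnW h).
Qed.

(** E_P is a vertex of its own petal and of those whose base contains it; the former is the extra
    unit, since E_P does not pass through P. *)
Lemma incident_petals_card (X : {fset ipoint R}) :
  [set Q | active C Q /\ passes (Exc P) Q] = [set` X] ->
  (incident_petals C (Exc P) #= `I_(#|` X|.+1))%card.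
Proof.
move=> eX.
have memX Q : Q \in X <-> active C Q /\ passes (Exc P) Q.
  by have := congr1 (fun A : set _ => A Q) eX => /= ->.
have lP : lotus_vertex C (Exc P) by apply/lotus_vertexE.
have -> : incident_petals C (Exc P) = petal_at C @` [set` (P |` X)%fset].
  apply/seteqP; split=> T.
    move=> [[Q aQ <-] [[<-]|[_ [I _ gI]]]].
      by exists P => //=; rewrite in_fsetE /= in_fset1 eqxx.
    by exists Q => //=; rewrite in_fset1U; apply/orP; right; apply/memX; split=> //; exists I.
  move=> [Q /=]; rewrite in_fset1U => /orP[/eqP ->|/memX[aQ [I gI]]] <-.
    by split; [exists P | left].
  split; first by exists Q.
  by right; split; [exact: lP | exists I => //; apply: germ_cross gI].
have inj : {in [set` (P |` X)%fset] &, injective (petal_at C)}.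
  have act Q : Q \in [set` (P |` X)%fset] -> Q \in [set Q | active C Q].
    by rewrite !inE /= in_fset1U => /orP[/eqP ->|/memX[]].
  by move=> Q Q' /act aQ /act aQ'; apply: petal_at_inj.
apply: (card_eq_trans (inj_card_eq inj)); apply/card_eq_fsetP.
rewrite cardfsU1; suff -> : P \notin X by [].
by apply/negP => /memX[_ [I /germ_bound/ilt_size]]; rewrite ltnn.
Qed.

End Weight.

Theorem proposition6p2 (R : realType) (C : constellation R) :
  exists (phi : curve R -> curve R) (psi : set (curve R) -> ipoint R),
    [/\ graph_isomorphism (lateral_boundary C) (dual_graph C) phi psi,
        forall P : ipoint R, active C P -> phi (Exc P) = Exc P &
        forall v : curve R, lateral_vertex C v ->
          exists2 n : nat,
            (incident_petals C v #= `I_n)%card &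
            weight C (phi v) = Some (- n%:Z)].
Proof.
have [phi [psi [iso phiE]]] := lateral_boundary_iso C.
exists phi, psi; split=> // v [P aP <-].
have : finite_set [set Q | active C Q /\ passes (Exc P) Q].
  by apply: sub_finite_set (points_finite C) => Q [aQ _]; apply: active_points.
move=> /finite_fsetP[X eX]; exists (#|` X|.+1); first exact: incident_petals_card.
by rewrite phiE //= (self_intersectionE aP eX).
Qed.
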